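(* There exists a constant $\varepsilon > 0$ such that the following holds. Let $n \in 3\mathbb{N}$ (a positive multiple of $3$), let $p \in [0,1]$, and let $G$ be a graph on $n$ vertices which is $(p, \varepsilon n p^2/\log n)$-bijumbled and has minimum degree at least $np/2$. Then $G$ contains a triangle-factor.
   Context: Graphs are finite and simple. For $p \in [0,1]$ and $\beta > 0$, a graph $G$ is $(p,\beta)$-bijumbled if for all subsets $X, Y \subseteq V(G)$ (not necessarily disjoint) we have $\left| e(X,Y) - |X||Y|p \right| \le \beta \sqrt{|X||Y|}$, where $e(X,Y)$ is the number of edges of $G$ with one endpoint in $X$ and the other in $Y$, and every edge with both endpoints in $X \cap Y$ is counted twice. A triangle-factor in a graph on $n$ vertices, $n$ divisible by $3$, is a family of $n/3$ pairwise vertex-disjoint triangles (copies of $K_3$ as subgraphs) of the graph. *)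

(* Defs.v *)
From mathcomp Require Import all_boot all_order all_algebra.
From mathcomp Require Import reals exp.

Set Implicit Arguments.
Unset Strict Implicit.
Unset Printing Implicit Defensive.

Import Order.TTheory GRing.Theory Num.Theory.
Local Open Scope ring_scope.

Record sgraph := SGraph {
  vertex :> finType;
  adj : rel vertex;
  adj_sym : symmetric adj;
  adj_irrefl : irreflexive adj
}.

Definition edges (G : sgraph) : {set {set G}} :=
  [set [set xy.1; xy.2] | xy : G * G & adj xy.1 xy.2].

Definition joins (G : sgraph) (X Y f : {set G}) : bool :=
  [exists x in X, exists y in Y, f == [set x; y]].

(* The second summand makes the edges with both endpoints in X :&: Y count
   twice. *)
Definition edges_between (G : sgraph) (X Y : {set G}) : nat :=
  (#|[set f in edges G | joins X Y f]|
   + #|[set f in edges G | f \subset X :&: Y]|)%N.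

(* The condition 0 < beta matters: an edgeless graph satisfies the remaining
   conditions for p = beta = 0. *)
Definition bijumbled (R : realType) (G : sgraph) (p beta : R) : Prop :=
  [/\ 0 <= p <= 1, 0 < beta &
    forall X Y : {set G},
      `|(edges_between X Y)%:R - #|X|%:R * #|Y|%:R * p|
        <= beta * Num.sqrt (#|X|%:R * #|Y|%:R)].

Definition degree (G : sgraph) (v : G) : nat := #|[set w | adj v w]|.

(* Degrees are smaller than #|G|, so this default only shows when G has no
   vertex. *)
Definition min_degree (G : sgraph) : nat :=
  \big[minn/#|G|]_(v : G) degree v.

(* A triangle is given by its vertex set, which determines it. *)
Definition triangle (G : sgraph) (t : {set G}) : bool :=
  (#|t| == 3)%N && [forall x in t, forall y in t, (x != y) ==> adj x y].

Definition triangle_factor (G : sgraph) (F : {set {set G}}) : bool :=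
  [&& (#|F| == #|G| %/ 3)%N, trivIset F & [forall t in F, triangle t]].

(* Main.v *)
Require Import Defs.
From mathcomp Require Import all_boot all_order all_algebra.
From mathcomp Require Import reals exp.
From mathcomp Require Import zify ring lra.

Import Order.TTheory GRing.Theory Num.Theory.

Set Implicit Arguments.
Unset Strict Implicit.

Local Open Scope nat_scope.

(** Put mu = eps * n / ln n, so that the graph is (p, mu p^2)-bijumbled.
    For two copies of a single vertex this says 1 <= mu p; in particular n
    is large and p is not too small.  Two consequences of jumbledness are
    used all the time: sets X, Y with |X| |Y| > (mu p)^2 span an edge, and
    at most 4 (mu p)^2 / |Y| vertices have fewer than half of the expected p
    |Y| neighbours in a set Y.  Together they show that any four sets of M
    vertices, where M is slightly above 4 mu, contain a transversal diamond,
    that is, two triangles sharing an edge ([square_jumbled_diamond_rich]);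
    in particular any three such sets contain a transversal triangle.
    Choosing disjoint triangles greedily thus leaves O(mu) vertices
    uncovered, and the whole difficulty is to absorb those.

    Absorption uses flexible sets: vertex sets S such that S minus r is a
    disjoint union of triangles for at least a third of the vertices r of S.
    The two corners of a diamond off its middle edge may lie in two flexible
    sets; adding the middle edge then merges them ([flexible_join2]), and in
    this way flexible sets of any prescribed size O(M) arise
    ([exists_flexible]).  If three disjoint flexible sets have removable
    vertices that form a triangle, then their union splits into triangles
    ([tileable_join3]).  So a flexible set behaves like a single vertex,
    except that it has many more neighbours.

    The absorber is a sequence of levels; the sets of each level are about
    twice as large as those of the level before, and every level has about
    26000 M vertices.  There are O(log n) levels, hence O(mu log n) = O(eps
    n) vertices in total: this is what the logarithm in the hypothesis pays
    for.  What is left over before a level, a family of flexible sets of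
    size at least l, is matched completely to disjoint pairs of sets of that
    level; then the unused sets of the level are combined greedily in threes
    until only O(M) vertices remain.  Those form the input for the next
    level ([absorber_halve]).  Once the sets have 3 M vertices, any three of
    them can be combined, so at most two remain, and then none, because the
    number of vertices is divisible by 3 and every flexible set has size 1
    modulo 3 ([absorber_large]).

    The complete matching is a matching in a 3-uniform hypergraph.  It
    exists by a Hall-type theorem in the style of Haxell
    ([disjoint_choice_exists]).  If its condition failed, then some s of the
    leftover sets would have at least s l / 3 removable vertices, and half
    of those would have a quarter of the expected number of neighbours in
    one half of the level inside a union of at most 4 s of its sets, which
    has O(s l) vertices; jumbledness forbids this because the level is much
    larger than mu ([square_jumbled_link_rich]).  This argument needs
    vertices that are not sparse into the level.  Each level is therefore
    chosen away from the few vertices that are sparse into the following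
    one.  For the first level these vertices, at most mu p^2 in number, are
    covered by triangles in advance; a reserved set W of n/3 vertices
    supplies the other two vertices of such a triangle, and the minimum
    degree is needed only for the vertices that are sparse into W itself
    ([tileable_of_rich]). *)

(** * Disjoint choices of hyperedges *)

Definition disjoint_choice (aT bT : finType) (H : aT -> {set {set bT}})
    (D : {set aT}) (f : aT -> {set bT}) : Prop :=
  (forall a, a \in D -> f a \in H a) /\
  (forall a b, a \in D -> b \in D -> a != b -> [disjoint f a & f b]).

Lemma disjoint_choice_update (aT bT : finType) (H : aT -> {set {set bT}})
    (D : {set aT}) (f : aT -> {set bT}) (a : aT) (e : {set bT}) :
  disjoint_choice H (D :\ a) f -> e \in H a ->
  (forall d, d \in D -> d != a -> [disjoint e & f d]) ->
  disjoint_choice H D (fun x => if x == a then e else f x).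
Proof.
move=> [fH fD] eH eD; split=> [x xD | x y xD yD xy].
  by case: eqP => [-> //|/eqP nxa]; apply: fH; rewrite !inE nxa.
have [xa|nxa] := eqVneq x a; have [ya|nya] := eqVneq y a.
- by rewrite xa ya eqxx in xy.
- by apply: eD.
- by rewrite disjoint_sym; apply: eD.
- by apply: fD => //; rewrite !inE ?nxa ?nya.
Qed.

(** The induction behind the Hall-type theorem below.  In a partial choice
    [f] on [D], a free edge, one that meets no chosen edge, is wanted at
    some vertex of [S], away from [U], at the price of changing [f] outside
    [S] only.  The hypothesis supplies an edge [e1] away from [U], but it
    may meet chosen edges, its blockers.  The blockers are added to [S], and
    all edges involved to [U]; the slack in the hypothesis leaves room for
    that.  If the induction then finds a free edge at a blocker, switching
    to it unblocks [e1] by one.  The third clause of the conclusion, that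
    changed edges avoid [U], ensures that no new blocker of [e1] appears. *)
Lemma free_edge_after_switching (aT bT : finType) (H : aT -> {set {set bT}})
    (r : nat) (X D : {set aT}) (k : nat) (S : {set aT}) (U : {set bT})
    (f : aT -> {set bT}) :
  (forall a e, a \in X -> e \in H a -> #|e| <= r) ->
  (forall (S' : {set aT}) (U' : {set bT}), S' \subset X -> S' != set0 -> #|U'| <= 2 * r * #|S'| ->
     exists a e, [/\ a \in S', e \in H a & [disjoint e & U']]) ->
  D \subset X -> S \subset X -> S != set0 -> #|D :\: S| < k ->
  #|U| + 2 * r <= 2 * r * #|S| ->
  disjoint_choice H D f -> (forall d, d \in D -> d \in S -> f d \subset U) ->
  exists f' a e,
    [/\ disjoint_choice H D f',
        (forall d, d \in D -> d \in S -> f' d = f d),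
        (forall d, d \in D -> f' d = f d \/ [disjoint f' d & U]),
        [/\ a \in S, e \in H a & [disjoint e & U]] &
        forall d, d \in D -> [disjoint e & f' d]].
Proof.
move=> Hr HS DX; elim: k S U f => // k IHk S U f SX S0 DSk Usz fM fSU.
have [|a1 [e1 [a1S e1H e1U]]] := HS S U SX S0; first by lia.
pose b (g : aT -> {set bT}) := [set d in D | ~~ [disjoint e1 & g d]].
(* The choice is improved repeatedly, with ever fewer blockers of [e1]. *)
have inner m f1 : disjoint_choice H D f1 ->
    (forall d, d \in D -> d \in S -> f1 d = f d) ->
    (forall d, d \in D -> f1 d = f d \/ [disjoint f1 d & U]) ->
    #|b f1| <= m ->
    exists f' a e,
    [/\ disjoint_choice H D f',
        (forall d, d \in D -> d \in S -> f' d = f d),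
        (forall d, d \in D -> f' d = f d \/ [disjoint f' d & U]),
        [/\ a \in S, e \in H a & [disjoint e & U]] &
        forall d, d \in D -> [disjoint e & f' d]].
  elim: m f1 => [|m IHm] f1 f1M f1S f1U bm.
    exists f1, a1, e1; split=> // d dD; apply/negPn/negP=> nd.
    have : d \in b f1 by rewrite inE dD.
    by move: bm; rewrite leqn0 cards_eq0 => /eqP ->; rewrite inE.
  have [b0|/set0Pn bN0] := eqVneq (b f1) set0.
    exists f1, a1, e1; split=> // d dD; apply/negPn/negP=> nd.
    have : d \in b f1 by rewrite inE dD.
    by rewrite b0 inE.
  have bD : b f1 \subset D by apply/subsetP=> d; rewrite inE => /andP[].
  have bS d : d \in b f1 -> d \notin S.
    rewrite inE => /andP[dD]; apply: contra => dS.
    by rewrite f1S //; apply: disjointWr e1U; apply: fSU.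
  pose S2 := S :|: b f1; pose U2 := U :|: e1 :|: \bigcup_(d in b f1) f1 d.
  have cS2 : #|S2| = #|S| + #|b f1|.
    rewrite cardsU; suff -> : S :&: b f1 = set0 by rewrite cards0 subn0.
    by apply/setP=> d; rewrite in_setI in_set0; apply/negP=> /andP[dS /bS/negP].
  have b_gt0 : 0 < #|b f1| by rewrite card_gt0; apply/set0Pn.
  have cU2 : #|U2| <= #|U| + r + #|b f1| * r.
    apply: leq_trans (leq_card_setU _ _) _; apply: leq_add.
      apply: leq_trans (leq_card_setU _ _) _; rewrite leq_add2l.
      by apply: (Hr a1); rewrite ?(subsetP SX).
    apply: (@leq_trans (\sum_(d in b f1) #|f1 d|)).
      elim/big_rec2: _ => [|d A m' _ Am]; first by rewrite cards0.
      by apply: leq_trans (leq_card_setU _ _) _; rewrite leq_add2l.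
    rewrite -sum_nat_const; apply: leq_sum => d db; have dD := subsetP bD _ db.
    by apply: (Hr d); [apply: (subsetP DX) | case: f1M => + _; apply].
  (* Each blocker adds one vertex to [S2] and at most [r] points to [U2], and
     [e1] itself at most [r] further ones; as there is a blocker, [2 * r] per
     new vertex is enough. *)
  have [||||||f' [a' [e' [f'M f'S f'U [a'S2 e'H e'U] e'D]]]] := IHk S2 U2 f1.
  - by rewrite subUset SX (subset_trans bD DX).
  - by case/set0Pn: S0 => x xS; apply/set0Pn; exists x; rewrite inE xS.
  - apply: leq_trans (_ : #|D :\: S| <= k); last by rewrite -ltnS.
    apply: proper_card; apply/properP; split.
      by apply: setDS; apply: subsetUl.
    case: bN0 => d db; exists d; first by rewrite inE bS // (subsetP bD).
    by rewrite in_setD in_setU db orbT.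
  - by rewrite cS2; nia.
  - by [].
  - move=> d dD; rewrite inE => /orP[dS|db].
      by rewrite f1S //; apply: subset_trans (fSU d dD dS) _;
         rewrite /U2 -setUA subsetUl.
    by apply: subset_trans (subsetUr _ _); apply: (bigcup_sup d).
  have UU2 : U \subset U2 by rewrite /U2 -setUA subsetUl.
  have e1U2 : e1 \subset U2.
    by apply: subset_trans (subsetUl _ _); apply: subsetUr.
  have f'Sf d : d \in D -> d \in S -> f' d = f d.
    by move=> dD dS; rewrite f'S ?f1S // inE dS.
  have f'Uf d : d \in D -> f' d = f d \/ [disjoint f' d & U].
    move=> dD; case: (f'U d dD) => [->|]; first exact: f1U.
    by move/(disjointWr UU2); right.
  have [a'S|a'nS] := boolP (a' \in S).
    by exists f', a', e'; split=> //; split=> //; apply: disjointWr e'U.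
  have a'b : a' \in b f1 by move: a'S2; rewrite inE (negPf a'nS).
  have a'D := subsetP bD _ a'b.
  apply: (IHm (fun x => if x == a' then e' else f' x)).
  - apply: disjoint_choice_update => //; last by move=> d dD _; apply: e'D.
    case: f'M => f'H f'D; split=> [x|x y]; first by case/setD1P=> _; apply: f'H.
    by case/setD1P=> _ xD /setD1P[_ yD]; apply: f'D.
  - move=> d dD dS; case: eqP => [da|_]; last exact: f'Sf.
    by rewrite -da dS in a'nS.
  - move=> d dD; case: eqP => [_|_]; last exact: f'Uf.
    by right; apply: disjointWr e'U.
  - rewrite -ltnS; apply: leq_trans bm.
    apply: proper_card; apply/properP; split; last first.
      exists a' => //; rewrite inE a'D eqxx negbK disjoint_sym.
      exact: disjointWr e'U.
    apply/subsetP=> d; rewrite !inE => /andP[dD]; rewrite dD.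
    case: eqP => [->|_]; first by case/setIdP: a'b.
    case: (f'U d dD) => [-> //|dU2]; case/negP; rewrite disjoint_sym.
    exact: disjointWr dU2.
by apply: (inner #|b f| f) => // d dD; left.
Qed.

(** A hypergraph version of the marriage theorem, in the spirit of Haxell.
    The factor [2 * r] is what the switching argument needs: a new vertex of
    the alternating structure brings in its own chosen edge and at most one
    further edge, the one that it blocks. *)
Theorem disjoint_choice_exists (aT bT : finType) (H : aT -> {set {set bT}})
    (r : nat) (X : {set aT}) :
  (forall a e, a \in X -> e \in H a -> #|e| <= r) ->
  (forall (S : {set aT}) (U : {set bT}), S \subset X -> S != set0 -> #|U| <= 2 * r * #|S| ->
     exists a e, [/\ a \in S, e \in H a & [disjoint e & U]]) ->
  exists f, disjoint_choice H X f.
Proof.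
move=> Hr HS.
suff aux k (D : {set aT}) : D \subset X -> #|D| <= k -> exists f, disjoint_choice H D f.
  by apply: (aux #|X|).
elim: k D => [|k IHk] D DX Dk.
  exists (fun _ => set0); split=> a; have: #|D| == 0 by lia.
    by rewrite cards_eq0 => /eqP->; rewrite inE.
  by rewrite cards_eq0 => /eqP-> b; rewrite inE.
have [->|/set0Pn[a0 a0D]] := eqVneq D set0.
  by exists (fun _ => set0); split=> a; rewrite ?inE // => b; rewrite inE.
have D'X : D :\ a0 \subset X by rewrite (subset_trans _ DX) // subsetDl.
have [|f fM] := IHk (D :\ a0) D'X.
  by rewrite (cardsD1 a0) a0D in Dk.
have [||||||f' [a [e [f'M _ _ [aS eH _] eD]]]] :=
  @free_edge_after_switching _ _ H r X (D :\ a0) #|D|.+1 [set a0] set0 f Hr HS D'X.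
- by rewrite sub1set (subsetP DX).
- by apply/set0Pn; exists a0; rewrite inE.
- by rewrite ltnS subset_leq_card // (subset_trans (subsetDl _ _)) // subsetDl.
- by rewrite cards0 cards1; lia.
- exact: fM.
- by move=> d /setD1P[/negPf da _]; rewrite inE da.
move: aS; rewrite inE => /eqP aa0; rewrite aa0 in eH.
exists (fun x => if x == a0 then e else f' x).
apply: disjoint_choice_update => // d dD da; apply: eD.
by rewrite !inE da.
Qed.

(** * Triangle tilings and flexible sets *)

Lemma disjoint_setP (T : finType) (A B : {set T}) :
  reflect (forall x, x \in A -> x \in B -> False) [disjoint A & B].
Proof.
apply: (iffP idP) => [dAB x xA xB | AB].
  by rewrite (disjointFr dAB xA) in xB.
rewrite disjoints_subset; apply/subsetP=> x xA.
by rewrite inE; apply/negP=> /(AB x xA).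
Qed.

Lemma card_disjointU (T : finType) (A B : {set T}) :
  [disjoint A & B] -> #|A :|: B| = #|A| + #|B|.
Proof. by rewrite -setI_eq0 cardsU => /eqP->; rewrite cards0 subn0. Qed.

Lemma setUD (T : finType) (A B : {set T}) : A \subset B -> A :|: (B :\: A) = B.
Proof. by move=> AB; rewrite -{1}(setIidPr AB) setID. Qed.

Lemma coverU (T : finType) (P Q : {set {set T}}) :
  cover (P :|: Q) = cover P :|: cover Q.
Proof. exact: bigcup_setU. Qed.

Lemma cover0 (T : finType) : cover (set0 : {set {set T}}) = set0.
Proof. by rewrite /cover big_set0. Qed.

Lemma coverS (T : finType) (P Q : {set {set T}}) :
  P \subset Q -> cover P \subset cover Q.
Proof. by move=> PQ; rewrite -(setUD PQ) coverU subsetUl. Qed.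

Lemma disjoint_cover (T : finType) (P A B : {set {set T}}) :
  trivIset P -> A \subset P -> B \subset P -> [disjoint A & B] ->
  [disjoint cover A & cover B].
Proof.
move=> /trivIsetP tP /subsetP AP /subsetP BP /disjoint_setP AB.
apply/disjoint_setP=> x /bigcupP[S SA xS] /bigcupP[S' SB xS'].
have [SS'|SS'] := eqVneq S S'; first by apply: (AB S) => //; rewrite SS'.
by have /disjoint_setP/(_ x xS xS') := tP S S' (AP _ SA) (BP _ SB) SS'.
Qed.

Lemma disjointD (T : finType) (A B : {set T}) : [disjoint A & B :\: A].
Proof. by apply/disjoint_setP=> x xA; rewrite inE xA. Qed.

Lemma card_coverD (T : finType) (P Q : {set {set T}}) :
  trivIset P -> Q \subset P -> #|cover P| = #|cover Q| + #|cover (P :\: Q)|.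
Proof.
move=> tP QP; rewrite -card_disjointU; last first.
  by apply: (disjoint_cover tP) => //; [apply: subsetDl | apply: disjointD].
by rewrite -coverU setUD.
Qed.

Lemma card_cover_bounds (T : finType) (P : {set {set T}}) (a b : nat) :
  trivIset P -> (forall S, S \in P -> a <= #|S| <= b) ->
  #|P| * a <= #|cover P| <= #|P| * b.
Proof.
move=> /eqP <- Pab; rewrite -!sum_nat_const.
by apply/andP; split; apply: leq_sum => S /Pab /andP[].
Qed.

(** A minimal subfamily covering at least [a] points overshoots [a] by less
    than the size of one member. *)
Lemma subfamily_of_size (T : finType) (P : {set {set T}}) (a b : nat) :
  (forall S, S \in P -> #|S| <= b) -> a <= #|cover P| ->
  exists Q : {set {set T}}, Q \subset P /\ a <= #|cover Q| <= a + b.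
Proof.
move=> Pb aP.
have [Q /minsetP[aQ minQ] QP] :=
  @minset_exists _ [pred Q : {set {set T}} | a <= #|cover Q|] P aP.
exists Q; split=> //; apply/andP; split; first exact: aQ.
have [Q0|/set0Pn[S SQ]] := eqVneq Q set0; first by rewrite Q0 cover0 cards0.
have lt : #|cover (Q :\ S)| < a.
  rewrite ltnNge; apply/negP=> aQS.
  have := minQ (Q :\ S) aQS (subsetDl _ _) => /setP/(_ S).
  by rewrite !inE eqxx SQ.
have -> : cover Q = S :|: cover (Q :\ S).
  by rewrite -{1}(setD1K SQ) coverU cover1.
rewrite addnC; apply: leq_trans (leq_card_setU _ _) _.
by apply: leq_add; [apply: Pb; apply: (subsetP QP) | apply: ltnW].
Qed.

Definition tileable (G : sgraph) (S : {set G}) : bool :=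
  [exists F : {set {set G}}, partition F S && [forall t in F, triangle t]].

Lemma tileable0 (G : sgraph) : tileable (set0 : {set G}).
Proof.
apply/existsP; exists set0; rewrite partition_set0 eqxx.
by apply/forall_inP=> t; rewrite inE.
Qed.

Lemma tileableU (G : sgraph) (A B : {set G}) :
  [disjoint A & B] -> tileable A -> tileable B -> tileable (A :|: B).
Proof.
move=> dAB /existsP[E /andP[/and3P[/eqP cE tE E0] /forall_inP Et]].
move=> /existsP[F /andP[/and3P[/eqP cF tF F0] /forall_inP Ft]].
apply/existsP; exists (E :|: F); apply/andP; split.
  apply/and3P; split; first by rewrite coverU cE cF.
    by apply: trivIsetU => //; rewrite cE cF.
  by rewrite inE negb_or E0.
by apply/forall_inP=> t /setUP[/Et | /Ft].
Qed.

Lemma tileable_dvd3 (G : sgraph) (S : {set G}) : tileable S -> 3 %| #|S|.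
Proof.
case/existsP=> F /andP[pF /forall_inP Ft].
rewrite (@card_uniform_partition _ 3 F S) ?dvdn_mull // => t /Ft.
by case/andP=> /eqP.
Qed.

Lemma tileable_setT_factor (G : sgraph) :
  tileable [set: G] -> exists F : {set {set G}}, triangle_factor F.
Proof.
case/existsP=> F /andP[pF /forall_inP Ft]; exists F; apply/and3P; split.
- have := @card_uniform_partition _ 3 F [set: G] _ pF.
  rewrite cardsT => -> //; first by rewrite mulnK.
  by move=> t /Ft /andP[/eqP].
- exact: partition_trivIset pF.
- exact/forall_inP.
Qed.

Lemma adj_neq (G : sgraph) (x y : G) : adj x y -> x != y.
Proof. by apply: contraTneq => ->; rewrite adj_irrefl. Qed.

Lemma tileable_triangle (G : sgraph) (x y z : G) :
  adj x y -> adj x z -> adj y z -> tileable [set x; y; z].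
Proof.
move=> xy xz yz; apply/existsP; exists [set [set x; y; z]]; apply/andP; split.
  apply/and3P; split; rewrite ?cover1 ?trivIset1 // inE eq_sym.
  by apply/set0Pn; exists x; rewrite !inE eqxx.
apply/forall_inP=> t; rewrite inE => /eqP->; apply/andP; split.
  rewrite setUC cardsU1 cards2 !inE negb_or (adj_neq xy).
  by rewrite ![z == _]eq_sym (adj_neq xz) (adj_neq yz).
apply/forall_inP=> u; rewrite !inE -orbA => /or3P[]/eqP->;
apply/forall_inP=> v; rewrite !inE -orbA => /or3P[]/eqP->;
by rewrite ?eqxx //= ?xy ?xz ?yz ?implybT // adj_sym ?xy ?xz ?yz ?implybT.
Qed.

(** Recording all vertices whose deletion leaves a tileable set, instead of
    a chosen list of them, lets a flexible set be described by its vertex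
    set alone. *)
Definition removable (G : sgraph) (S : {set G}) : {set G} :=
  [set r in S | tileable (S :\ r)].

(** The additive constant makes the notion stable under joining two sets by
    the middle edge of a diamond, which adds two vertices. *)
Definition flexible (G : sgraph) (S : {set G}) : bool :=
  #|S| + 2 <= 3 * #|removable S|.

Lemma removable_sub (G : sgraph) (S : {set G}) : removable S \subset S.
Proof. by apply/subsetP=> r; rewrite inE => /andP[]. Qed.

Lemma removable_set1 (G : sgraph) (v : G) : removable [set v] = [set v].
Proof.
apply/setP=> r; rewrite /removable !inE.
by case: eqP => //= ->; rewrite setDv tileable0.
Qed.

Lemma flexible_set1 (G : sgraph) (v : G) : flexible [set v].
Proof. by rewrite /flexible removable_set1 cards1. Qed.

Lemma flexible_gt0 (G : sgraph) (S : {set G}) : flexible S -> 0 < #|S|.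
Proof.
move=> fS; have := subset_leq_card (removable_sub S).
by move: fS; rewrite /flexible; lia.
Qed.

(** Some vertex can be removed, and what is left has size divisible by 3. *)
Lemma flexible_mod3 (G : sgraph) (S : {set G}) : flexible S -> #|S| %% 3 = 1.
Proof.
rewrite /flexible => fS; have /card_gt0P[r] : 0 < #|removable S| by lia.
rewrite inE => /andP[rS /tileable_dvd3].
by rewrite (cardsD1 r S) rS => d; lia.
Qed.

(** The triangle on the three removable vertices is one tile; what remains
    of each set is tileable by the choice of these vertices. *)
Lemma tileable_join3 (G : sgraph) (S1 S2 S3 : {set G}) (a b c : G) :
  [disjoint S1 & S2] -> [disjoint S1 & S3] -> [disjoint S2 & S3] ->
  a \in removable S1 -> b \in removable S2 -> c \in removable S3 ->
  adj a b -> adj a c -> adj b c -> tileable (S1 :|: S2 :|: S3).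
Proof.
move=> /disjoint_setP d12 /disjoint_setP d13 /disjoint_setP d23.
rewrite !inE => /andP[aS ta] /andP[bS tb] /andP[cS tc] ab ac bc.
have -> : S1 :|: S2 :|: S3 =
    [set a; b; c] :|: ((S1 :\ a) :|: ((S2 :\ b) :|: (S3 :\ c))).
  apply/setP=> x; rewrite !inE.
  case: eqP => [->|_]; first by rewrite aS.
  case: eqP => [->|_]; first by rewrite bS !orbT.
  by case: eqP => [->|_]; [rewrite cS !orbT | rewrite /= orbA].
apply: tileableU; last apply: tileableU => //; last apply: tileableU => //.
- apply/disjoint_setP=> x; rewrite !inE -orbA => xT /or3P[]/andP[xn xS];
  move: xT; rewrite (negPf xn) ?orbF /= => /orP[]/eqP xe; rewrite xe in xS.
  + exact: (d12 b).
  + exact: (d13 c).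
  + exact: (d12 a).
  + exact: (d23 c).
  + exact: (d13 a).
  + exact: (d23 b).
- exact: tileable_triangle.
- apply/disjoint_setP=> x; rewrite !inE => /andP[_ x1] /orP[]/andP[_ x2].
    exact: (d12 x).
  exact: (d13 x).
- apply/disjoint_setP=> x; rewrite !inE => /andP[_ x1] /andP[_ x2].
  exact: (d23 x).
Qed.

(** If a vertex of one set is removed, then the edge [x y] completes a
    triangle with the designated vertex of the other set, and both sets lose
    exactly one removable vertex. *)
Lemma removable_join2 (G : sgraph) (S1 S2 : {set G}) (v w x y : G) :
  [disjoint S1 & S2] -> v \in removable S1 -> w \in removable S2 ->
  x \notin S1 :|: S2 -> y \notin S1 :|: S2 ->
  adj x y -> adj x v -> adj y v -> adj x w -> adj y w ->
  removable S1 :|: removable S2 \subset removable (S1 :|: S2 :|: [set x; y]).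
Proof.
suff main (A B : {set G}) a b : [disjoint A & B] -> b \in removable B ->
    a \in removable A -> x \notin A :|: B -> y \notin A :|: B ->
    adj x y -> adj x b -> adj y b -> a \in removable (A :|: B :|: [set x; y]).
  move=> d12 v1 w2 xS yS xy xv yv xw yw.
  apply/subsetP=> a /setUP[a1|a2]; first exact: (main S1 S2 a w).
  rewrite (setUC S1); apply: (main S2 S1 a v) => //.
  - by rewrite disjoint_sym.
  - by rewrite setUC.
  - by rewrite setUC.
move=> /disjoint_setP dAB; rewrite !inE !negb_or.
move=> /andP[bB tB] /andP[aA tA] /andP[xA xB] /andP[yA yB] xy xb yb.
rewrite aA /=.
have -> : (A :|: B :|: [set x; y]) :\ a =
    (A :\ a) :|: ((B :\ b) :|: [set x; y; b]).
  apply/setP=> z; rewrite !inE.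
  have [->|za] /= := eqVneq z a.
    apply/esym/negP; rewrite andbC.
    case/orP; first by case/andP=> /(dAB a aA).
    case/orP; last by move/eqP=> ab; apply: (dAB a) => //; rewrite ab.
    by case/orP=> /eqP ax; [move: xA | move: yA]; rewrite -ax aA.
  have [->|zb] /= := eqVneq z b; first by rewrite bB !orbT.
  by rewrite orbF -orbA.
apply: tileableU => //; last apply: tileableU => //.
- apply/disjoint_setP=> z; rewrite !inE => /andP[_ zA] /orP[/andP[_]|].
    exact: dAB.
  case/orP=> [/orP[]|] /eqP zz; rewrite zz in zA; first by rewrite zA in xA.
    by rewrite zA in yA.
  exact: (dAB b).
- apply/disjoint_setP=> z; rewrite !inE => /andP[zb zB].
  by rewrite (negPf zb) orbF => /orP[]/eqP zz; rewrite zz in zB;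
     [rewrite zB in xB | rewrite zB in yB].
- exact: tileable_triangle.
Qed.

(** * Building flexible sets and using them up greedily *)

(** The vertices [v] and [w] are the corners of a diamond, two triangles
    sharing the edge [x y]. *)
Definition diamond_rich (G : sgraph) (M : nat) : Prop :=
  forall D X Y W : {set G},
    M <= #|D| -> M <= #|X| -> M <= #|Y| -> M <= #|W| ->
    exists v x y w, [/\ v \in D, x \in X, y \in Y & w \in W] /\
      [/\ adj x y, adj x v, adj y v, adj x w & adj y w].

Definition rcover (G : sgraph) (P : {set {set G}}) : {set G} :=
  \bigcup_(S in P) removable S.

Definition flexible_family (G : sgraph) (P : {set {set G}}) : Prop :=
  trivIset P /\ forall S, S \in P -> flexible S.

Lemma flexible_familyS (G : sgraph) (P Q : {set {set G}}) :
  Q \subset P -> flexible_family P -> flexible_family Q.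
Proof.
by move=> QP [tP fP]; split=> [|S /(subsetP QP)]; [apply: trivIsetS tP | apply: fP].
Qed.

Lemma rcover_sub (G : sgraph) (P : {set {set G}}) : rcover P \subset cover P.
Proof.
apply/bigcupsP=> S SP; apply: subset_trans (removable_sub S) _.
exact: bigcup_sup.
Qed.

Lemma card_rcover (G : sgraph) (P : {set {set G}}) :
  flexible_family P -> #|cover P| <= 3 * #|rcover P|.
Proof.
move: {-1}#|P| (leqnn #|P|) => k; elim: k P => [|k IHk] P Pk fP.
  have P0 : P = set0 by apply/eqP; rewrite -cards_eq0; lia.
  by rewrite P0 cover0 cards0.
have [->|/set0Pn[S SP]] := eqVneq P set0; first by rewrite cover0 cards0.
have PS : P :\ S \subset P by apply: subsetDl.
have [tP /(_ S SP) fS] := fP.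
have {}IHk : #|cover (P :\ S)| <= 3 * #|rcover (P :\ S)|.
  apply: IHk; last exact: flexible_familyS fP.
  by rewrite (cardsD1 S) SP in Pk.
have -> : rcover P = removable S :|: rcover (P :\ S).
  by rewrite /rcover (big_setD1 S).
have S1 : [set S] \subset P by rewrite sub1set.
rewrite card_disjointU; last first.
  apply: disjointWl (removable_sub S) _; apply: disjointWr (rcover_sub _) _.
  by have := disjoint_cover tP S1 PS (disjointD _ _); rewrite cover1.
by rewrite (card_coverD tP S1) cover1; move: fS; rewrite /flexible; lia.
Qed.

(** Members of bounded size allow a subfamily with many removable vertices
    to be cut off while almost all of the rest is kept. *)
Lemma flexible_family_split (G : sgraph) (P : {set {set G}}) (a b : nat) :
  flexible_family P -> (forall S, S \in P -> #|S| <= b) ->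
  3 * a <= #|cover P| ->
  exists Q : {set {set G}}, [/\ Q \subset P, a <= #|rcover Q| &
    #|cover P| <= #|cover (P :\: Q)| + (3 * a + b)].
Proof.
move=> fP Pb aP; have [Q [QP /andP[aQ Qa]]] := subfamily_of_size Pb aP.
exists Q; split=> //.
  by have := card_rcover (flexible_familyS QP fP); lia.
by rewrite (card_coverD fP.1 QP); lia.
Qed.

Lemma rcoverP (G : sgraph) (P : {set {set G}}) (x : G) :
  x \in rcover P -> exists2 S, S \in P & x \in removable S.
Proof. by case/bigcupP=> S; exists S. Qed.

Lemma tileable_triple (G : sgraph) (P : {set {set G}}) (S1 S2 S3 : {set G})
    (a b c : G) :
  trivIset P -> S1 \in P -> S2 \in P -> S3 \in P ->
  S1 != S2 -> S1 != S3 -> S2 != S3 ->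
  a \in removable S1 -> b \in removable S2 -> c \in removable S3 ->
  adj a b -> adj a c -> adj b c -> tileable (cover [set S1; S2; S3]).
Proof.
move=> /trivIsetP tP P1 P2 P3 n12 n13 n23 a1 b2 c3 ab ac bc.
rewrite !coverU !cover1.
by apply: (@tileable_join3 _ S1 S2 S3 a b c) => //; apply: tP.
Qed.

(** The family is cut into three parts with [M] removable vertices each, and
    a triangle across the parts is found. *)
Lemma exists_tileable_triple (G : sgraph) (M b : nat) (P : {set {set G}}) :
  diamond_rich G M -> flexible_family P ->
  (forall S, S \in P -> #|S| <= b) -> 9 * M + 2 * b <= #|cover P| ->
  exists T : {set {set G}}, [/\ T \subset P, T != set0 & tileable (cover T)].
Proof.
move=> dM fP Pb szP.
have [|Q1 [Q1P MQ1 R1]] := @flexible_family_split G P M b fP Pb; first by lia.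
have fP1 := flexible_familyS (subsetDl P Q1) fP.
have [||Q2 [Q2P MQ2 R2]] := @flexible_family_split G (P :\: Q1) M b fP1.
- by move=> S /setDP[/Pb].
- by lia.
have fP2 := flexible_familyS (subsetDl (P :\: Q1) Q2) fP1.
have MQ3 : M <= #|rcover (P :\: Q1 :\: Q2)|.
  by have := card_rcover fP2; lia.
have [v [x [y [_ [[vD xX yY _] [xy xv yv _ _]]]]]] :=
  dM (rcover Q1) (rcover Q2) _ _ MQ1 MQ2 MQ3 MQ3.
have [S1 S1Q vS1] := rcoverP vD; have [S2 S2Q xS2] := rcoverP xX.
have [S3 S3Q yS3] := rcoverP yY.
have S1P := subsetP Q1P _ S1Q; have /setDP[S2P S2n] := subsetP Q2P _ S2Q.
have /setDP[/setDP[S3P S3n] S3n'] := S3Q.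
exists [set S1; S2; S3]; split.
- by apply/subsetP=> S; rewrite !inE => /orP[/orP[]|] /eqP->.
- by apply/set0Pn; exists S1; rewrite !inE eqxx.
- apply: (tileable_triple fP.1 S1P S2P S3P _ _ _ vS1 xS2 yS3) => //.
  + by apply: contraNneq S2n => <-.
  + by apply: contraNneq S3n => <-.
  + by apply: contraNneq S3n' => <-.
  + by rewrite adj_sym.
  + by rewrite adj_sym.
Qed.

Lemma exists_tileable_triple_large (G : sgraph) (M : nat) (P : {set {set G}}) :
  diamond_rich G M -> flexible_family P ->
  (forall S, S \in P -> 3 * M <= #|S|) -> 2 < #|P| ->
  exists T : {set {set G}}, [/\ T \subset P, T != set0 & tileable (cover T)].
Proof.
move=> dM [tP fP] PM /card_gt2P[S1 [S2 [S3 [[P1 P2 P3] [n12 n23 n31]]]]].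
have large S : S \in P -> M <= #|removable S|.
  by move=> SP; have := PM S SP; have := fP S SP; rewrite /flexible; lia.
have [v [x [y [_ [[vD xX yY _] [xy xv yv _ _]]]]]] :=
  dM _ _ _ _ (large _ P1) (large _ P2) (large _ P3) (large _ P3).
exists [set S1; S2; S3]; split.
- by apply/subsetP=> S; rewrite !inE => /orP[/orP[]|] /eqP->.
- by apply/set0Pn; exists S1; rewrite !inE eqxx.
- apply: (tileable_triple tP P1 P2 P3 _ _ _ vD xX yY) => //.
  + by rewrite eq_sym.
  + by rewrite adj_sym.
  + by rewrite adj_sym.
Qed.

Lemma greedy_tiling (G : sgraph) (small : pred {set {set G}})
    (P : {set {set G}}) :
  trivIset P ->
  (forall Q : {set {set G}}, Q \subset P -> ~~ small Q ->
     exists T : {set {set G}}, [/\ T \subset Q, T != set0 & tileable (cover T)]) ->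
  exists Q : {set {set G}},
    [/\ Q \subset P, small Q & tileable (cover (P :\: Q))].
Proof.
move: {-1}#|P| (leqnn #|P|) => k; elim: k P => [|k IHk] P Pk tP step.
  have P0 : P = set0 by apply/eqP; rewrite -cards_eq0; lia.
  exists P; split=> //; last by rewrite setDv cover0 tileable0.
  apply: contraT => /step[//|T [TP /set0Pn[S ST]]].
  by have := subsetP TP S ST; rewrite P0 inE.
have [sP|nsP] := boolP (small P).
  by exists P; split=> //; rewrite setDv cover0 tileable0.
have [T [TP T0 tT]] := step P (subxx P) nsP.
have DP : P :\: T \subset P by apply: subsetDl.
have [|||Q [QD sQ tQ]] := IHk (P :\: T).
- have : 0 < #|T| by rewrite card_gt0.
  by rewrite cardsDS //; have := subset_leq_card TP; lia.
- exact: trivIsetS tP.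
- by move=> Q QD; apply: step; apply: subset_trans DP.
exists Q; split=> //; first exact: subset_trans DP.
have -> : P :\: Q = T :|: ((P :\: T) :\: Q).
  apply/setP=> S; rewrite !inE; case: (boolP (S \in T)) => ST //=.
  rewrite (subsetP TP) // andbT; apply/negP=> SQ.
  by have := subsetP QD S SQ; rewrite inE ST.
rewrite coverU; apply: tileableU => //.
apply: (disjoint_cover tP) => //; first by apply: subset_trans DP; apply: subsetDl.
by apply: disjointWr (disjointD T P); apply: subsetDl.
Qed.

Lemma flexible_join2 (G : sgraph) (S1 S2 : {set G}) (v w x y : G) :
  flexible S1 -> flexible S2 ->
  [disjoint S1 & S2] -> v \in removable S1 -> w \in removable S2 ->
  x \notin S1 :|: S2 -> y \notin S1 :|: S2 ->
  adj x y -> adj x v -> adj y v -> adj x w -> adj y w ->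
  flexible (S1 :|: S2 :|: [set x; y]).
Proof.
rewrite /flexible => f1 f2 d12 v1 w2 xS yS xy xv yv xw yw.
have := subset_leq_card (removable_join2 d12 v1 w2 xS yS xy xv yv xw yw).
rewrite card_disjointU; last first.
  by apply: disjointWl (removable_sub S1) _; apply: disjointWr (removable_sub S2) _.
have := (leq_card_setU (S1 :|: S2) [set x; y]).1.
rewrite (card_disjointU d12) cards2.
by move: f1 f2; clear; case: (x != y); lia.
Qed.

Lemma merge_flexible (G : sgraph) (M b : nat) (P : {set {set G}}) (F : {set G}) :
  diamond_rich G M -> flexible_family P ->
  (forall S, S \in P -> #|S| <= b) -> 6 * M + b <= #|cover P| ->
  [disjoint F & cover P] -> M <= #|F| ->
  exists S1 S2 x y, [/\ S1 \in P, S2 \in P, S1 != S2 &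
    [/\ x \in F, y \in F, x != y & flexible (S1 :|: S2 :|: [set x; y])]].
Proof.
move=> dM fP Pb szP /disjoint_setP dF MF.
have [|Q1 [Q1P MQ1 R1]] := @flexible_family_split G P M b fP Pb; first by lia.
have fP1 := flexible_familyS (subsetDl P Q1) fP.
have MQ2 : M <= #|rcover (P :\: Q1)| by have := card_rcover fP1; lia.
have [v [x [y [w [[vD xX yY wW] [xy xv yv xw yw]]]]]] := dM _ _ _ _ MQ1 MF MF MQ2.
have [S1 S1Q vS1] := rcoverP vD; have [S2 S2Q wS2] := rcoverP wW.
have S1P := subsetP Q1P _ S1Q; have /setDP[S2P S2n] := S2Q.
have n12 : S1 != S2 by apply: contraNneq S2n => <-.
have out z : z \in F -> z \notin S1 :|: S2.
  move=> zF; apply/negP=> zS; apply: (dF z zF); apply/bigcupP.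
  by case/setUP: zS; [exists S1 | exists S2].
exists S1, S2, x, y; split=> //; split=> //; first exact: adj_neq.
apply: (@flexible_join2 _ S1 S2 v w) => //; [exact: fP.2|exact: fP.2| |exact: out|exact: out].
by apply: (trivIsetP fP.1).
Qed.

Definition singletons (T : finType) (Z : {set T}) : {set {set T}} :=
  [set [set v] | v in Z].

Lemma cover_singletons (T : finType) (Z : {set T}) : cover (singletons Z) = Z.
Proof.
rewrite cover_imset; apply/setP=> x; apply/bigcupP/idP => [[v vZ]|xZ].
  by rewrite inE => /eqP->.
by exists x; rewrite ?inE.
Qed.

Lemma flexible_family_singletons (G : sgraph) (Z : {set G}) :
  flexible_family (singletons Z).
Proof.
split=> [|S /imsetP[v _ ->]]; last exact: flexible_set1.
apply/trivIsetP=> A B /imsetP[a _ ->] /imsetP[b _ ->] ab.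
apply/disjoint_setP=> x; rewrite !inE => /eqP-> /eqP e.
by rewrite e eqxx in ab.
Qed.

(** Start from a family of single vertices.  As long as all members are
    smaller than [l], the family can be cut into two parts with many
    removable vertices, and a diamond between the parts whose middle edge is
    fresh merges two members.  Each merge uses two fresh vertices and
    reduces the number of members by one, so that [#|cover P| + 2 * #|P|]
    stays constant and fresh vertices never run out. *)
Lemma exists_flexible (G : sgraph) (M l : nat) (Z : {set G}) :
  diamond_rich G M -> 0 < M -> 1 < l -> 22 * M + 3 * l <= #|Z| ->
  exists S : {set G}, [/\ S \subset Z, flexible S & l <= #|S| <= 2 * l].
Proof.
move=> dM M0 l1 szZ.
suff main k (P : {set {set G}}) : #|P| <= k -> flexible_family P ->
    cover P \subset Z -> (forall S, S \in P -> #|S| < l) ->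
    6 * M + l <= #|cover P| -> #|cover P| + 2 * #|P| <= 3 * (6 * M + l + 1) ->
    exists S : {set G}, [/\ S \subset Z, flexible S & l <= #|S| <= 2 * l].
  have sb S : S \in singletons Z -> #|S| <= 1.
    by case/imsetP=> v _ ->; rewrite cards1.
  have [|Q [QP /andP[aQ Qa]]] := @subfamily_of_size _ _ (6 * M + l) 1 sb.
    by rewrite cover_singletons; lia.
  have fQ := flexible_familyS QP (flexible_family_singletons Z).
  have s1 S : S \in Q -> 1 <= #|S| <= 1.
    by move=> /(subsetP QP)/imsetP[v _ ->]; rewrite cards1.
  have cQ := card_cover_bounds fQ.1 s1.
  apply: (main #|Q| Q) => //; last by lia.
  - by have := coverS QP; rewrite cover_singletons.
  - by move=> S /(subsetP QP)/sb; lia.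
elim: k P => [|k IHk] P Pk fP PZ Pl szP invP.
  have P0 : P = set0 by apply/eqP; rewrite -cards_eq0; lia.
  by move: szP; rewrite P0 cover0 cards0; lia.
have [||||S1 [S2 [x [y [S1P S2P n12 [xF yF nxy fS]]]]]] :=
  @merge_flexible G M l P (Z :\: cover P) dM fP.
- by move=> S /Pl /ltnW.
- by [].
- by rewrite disjoint_sym disjointD.
- by rewrite cardsDS //; have := subset_leq_card PZ; lia.
have /setDP[xZ xP] := xF; have /setDP[yZ yP] := yF.
have [S SE] : exists S, S = S1 :|: S2 :|: [set x; y] by eexists.
rewrite -SE in fS.
have subP A : A \in P -> A \subset cover P by move=> AP; apply: bigcup_sup.
have SZ : S \subset Z.
  rewrite SE !subUset !sub1set xZ yZ !andbT.
  by rewrite !(subset_trans (subP _ _) PZ).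
have d12 : [disjoint S1 & S2] by apply: (trivIsetP fP.1).
have dxy : [disjoint S1 :|: S2 & [set x; y]].
  apply/disjoint_setP=> z zS; rewrite !inE => zxy.
  have zP : z \in cover P.
    by case/setUP: zS => zS; apply: (subsetP (subP _ _)) zS.
  by case/orP: zxy => /eqP zz; move: zP; rewrite zz; apply/negP.
have cS : #|S| = #|S1| + #|S2| + 2.
  by rewrite SE card_disjointU // card_disjointU // cards2 nxy.
have [lS|Sl] := leqP l #|S|.
  exists S; split=> //; rewrite lS /=.
  by move: (Pl _ S1P) (Pl _ S2P) cS; clear; lia.
pose Q := [set S1; S2].
have QP : Q \subset P by rewrite subUset !sub1set S1P.
have cQ : cover Q = S1 :|: S2 by rewrite coverU !cover1.
have dSQ A : A \in P :\: Q -> [disjoint S & A].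
  move=> AD; rewrite disjoint_sym; have AP := subsetP (subsetDl _ _) _ AD.
  apply/disjoint_setP=> z zA; rewrite SE in_setU => /orP[zS|].
    have /disjoint_setP := disjoint_cover fP.1 QP (subsetDl P Q) (disjointD _ _).
    by apply; [rewrite cQ; apply: zS | apply/bigcupP; exists A].
  have zP := subsetP (subP _ AP) _ zA.
  by rewrite !inE => /orP[]/eqP zz; move: zP; rewrite zz; apply/negP.
have SnP : S \notin P :\: Q.
  apply/negP=> /dSQ; rewrite -setI_eq0 setIid => /eqP S0.
  by move: cS; rewrite S0 cards0 addn2.
have fP' : flexible_family (S |: (P :\: Q)).
  split=> [|A /setU1P[-> //|/setDP[/fP.2 //]]].
  apply: trivIsetU; [exact: trivIset1|exact: trivIsetD fP.1|].
  rewrite cover1; apply/disjoint_setP=> z zS /bigcupP[A AD zA].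
  by have /disjoint_setP/(_ z zS zA) := dSQ A AD.
have cP' : #|cover (S |: (P :\: Q))| = #|cover P| + 2.
  rewrite coverU cover1 card_disjointU; last first.
    apply/disjoint_setP=> z zS /bigcupP[A AD zA].
    by have /disjoint_setP/(_ z zS zA) := dSQ A AD.
  by rewrite cS (card_coverD fP.1 QP) cQ card_disjointU //; clear; lia.
have nP' : #|S |: (P :\: Q)| + 1 = #|P|.
  have Q2 : #|Q| = 2 by rewrite cards2 n12.
  by rewrite -(cardsID Q P) (setIidPr QP) Q2 cardsU1 SnP addnAC.
apply: (IHk (S |: (P :\: Q))) => //.
- by move: nP' Pk; clear; rewrite /reverse_coercion; lia.
- by rewrite coverU cover1 subUset SZ (subset_trans _ PZ) // coverS // subsetDl.
- by move=> A /setU1P[-> //|/setDP[/Pl]].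
- by move: cP' szP; clear; lia.
- by move: cP' nP' invP; clear; rewrite /reverse_coercion; lia.
Qed.

(** Flexible sets are added one at a time, outside those already found. *)
Lemma exists_flexible_family (G : sgraph) (M l t : nat) (Z : {set G}) :
  diamond_rich G M -> 0 < M -> 1 < l -> 22 * M + 5 * l + t <= #|Z| ->
  exists P : {set {set G}}, [/\ flexible_family P, cover P \subset Z,
    (forall S, S \in P -> l <= #|S| <= 2 * l) & t <= #|cover P| <= t + 2 * l].
Proof.
move=> dM M0 l1; elim: t => [|t IHt] szZ.
  exists set0; rewrite cover0 cards0 sub0set; split=> //.
    by split=> [|S]; rewrite ?inE // /trivIset cover0 big_set0 cards0.
  by move=> S; rewrite inE.
have [|P [fP PZ Pl /andP[tP Pt]]] := IHt; first by lia.
have [lt|ge] := ltnP t #|cover P|.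
  by exists P; split=> //; lia.
have [||||S [SZ fS lS]] := @exists_flexible G M l (Z :\: cover P) => //.
  by rewrite cardsDS //; lia.
have /subsetDP[SZ' dS] := SZ.
exists (S |: P); rewrite coverU cover1; split.
- split=> [|A /setU1P[-> //|/fP.2 //]].
  by apply: trivIsetU; rewrite ?trivIset1 ?cover1 //; exact: fP.1.
- by rewrite subUset SZ'.
- by move=> A /setU1P[->|/Pl].
- by rewrite card_disjointU //; lia.
Qed.

(** * Matching flexible sets to pairs of larger ones *)

(** This is what the matching into one level of the absorber needs from the
    graph: [A] and [B] stand for the removable vertices of the two halves of
    the level, [Q] for those of some leftover sets, [U] for the vertices of
    the sets of the level that must be avoided. *)
Definition link_rich (G : sgraph) (M d : nat) : Prop :=
  forall A B : {set G}, 4300 * M <= #|A| -> 4300 * M <= #|B| ->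
    exists Bad : {set G}, #|Bad| <= d /\
    forall Q U : {set G}, 0 < #|Q| -> [disjoint Q & Bad] ->
      #|U| <= 48 * #|Q| -> 8 * #|U| <= #|A| -> 8 * #|U| <= #|B| ->
      exists v a b, [/\ v \in Q, a \in A :\: U & b \in B :\: U] /\
        [/\ adj v a, adj v b & adj a b].

(** The bound [33 * M] is what the greedy combination of the preceding level
    may leave over, and [Bad] consists of vertices that may not be matchable
    into [Q]. *)
Definition absorber (G : sgraph) (M l : nat) (Q Bad : {set G}) : Prop :=
  forall X : {set {set G}}, flexible_family X ->
    (forall S, S \in X -> l <= #|S|) ->
    [disjoint cover X & Bad] -> [disjoint cover X & Q] ->
    #|X| * l <= 33 * M -> 3 %| #|cover X :|: Q| -> tileable (cover X :|: Q).

Lemma card_cover_mod3 (G : sgraph) (P : {set {set G}}) :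
  flexible_family P -> #|cover P| = #|P| %[mod 3].
Proof.
move=> [/eqP <- fP]; rewrite -sum1_card -modn_summ.
by congr (_ %% 3); apply: eq_bigr => S /fP /flexible_mod3.
Qed.

(** Any three sets of size [3 * M] have a triangle on their removable
    vertices, so greedily all but two sets are used up; modulo 3 each of the
    remaining sets counts as one vertex, so that none can remain. *)
Lemma absorber_large (G : sgraph) (M l : nat) :
  diamond_rich G M -> 3 * M <= l -> absorber M l (set0 : {set G}) set0.
Proof.
move=> dM Ml X fX Xl _ _ _; rewrite setU0 => X3.
have [Q QX nQ|Q [QX sQ tQ]] := @greedy_tiling G (fun P => #|P| <= 2) X fX.1.
  apply: (exists_tileable_triple_large dM (flexible_familyS QX fX)).
    by move=> S /(subsetP QX)/Xl; apply: leq_trans.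
  by rewrite ltnNge.
have : 3 %| #|cover Q|.
  by rewrite -(dvdn_addl _ (tileable_dvd3 tQ)) -(card_coverD fX.1 QX).
rewrite /dvdn (card_cover_mod3 (flexible_familyS QX fX)) => Q3.
have Q0 : Q = set0.
  apply/eqP; rewrite -cards_eq0; move: sQ Q3 => /=.
  by case: #|Q| => [|[|[|]]].
by rewrite Q0 setD0 in tQ.
Qed.

Lemma tileable_cover_bigcup (G : sgraph) (I : finType) (D : {set I})
    (P : {set {set G}}) (g : I -> {set {set G}}) :
  trivIset P -> (forall i, i \in D -> g i \subset P) ->
  (forall i j, i \in D -> j \in D -> i != j -> [disjoint g i & g j]) ->
  (forall i, i \in D -> tileable (cover (g i))) ->
  tileable (cover (\bigcup_(i in D) g i)).
Proof.
move: {-1}#|D| (leqnn #|D|) => k; elim: k D => [|k IHk] D Dk tP gP gd gt.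
  have -> : D = set0 by apply/eqP; rewrite -cards_eq0; lia.
  by rewrite big_set0 cover0 tileable0.
have [->|/set0Pn[i iD]] := eqVneq D set0.
  by rewrite big_set0 cover0 tileable0.
have DD j : j \in D :\ i -> j \in D by case/setD1P.
rewrite (big_setD1 i) //= coverU; apply: tileableU.
- apply: (disjoint_cover tP); first exact: gP.
    by apply/bigcupsP=> j /DD /gP.
  apply/disjoint_setP=> S Si /bigcupP[j jD Sj].
  have ij : i != j by case/setD1P: jD; rewrite eq_sym.
  by have /disjoint_setP/(_ S Si Sj) := gd i j iD (DD _ jD) ij.
- exact: gt.
- apply: IHk => //; first by rewrite (cardsD1 i) iD in Dk.
  + by move=> j /DD; apply: gP.
  + by move=> j1 j2 /DD j1D /DD; apply: gd.
  + by move=> j /DD; apply: gt.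
Qed.

(** Each member of [X] is matched to a pair in [Y1] times [Y2] with which it
    forms a tileable triple.  In the Hall-type condition, [s] members of [X]
    have at least [s * l / 3] removable vertices, while [4 * s] members of
    the level cover at most [16 * s * l] vertices, whence the ratio 48 in
    [link_rich]; and as [s * l] is at most [33 * M], 8 times the latter
    number is below [4300 * M]. *)
Lemma absorb_into_pairs (G : sgraph) (M l : nat) (X Y1 Y2 : {set {set G}})
    (Bad : {set G}) :
  flexible_family X -> flexible_family (Y1 :|: Y2) -> [disjoint Y1 & Y2] ->
  [disjoint cover X & cover (Y1 :|: Y2)] ->
  (forall S, S \in X -> l <= #|S|) -> 0 < l ->
  (forall S, S \in Y1 :|: Y2 -> #|S| <= 4 * l) ->
  4300 * M <= #|rcover Y1| -> 4300 * M <= #|rcover Y2| ->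
  [disjoint cover X & Bad] -> #|X| * l <= 33 * M ->
  (forall Q U : {set G}, 0 < #|Q| -> [disjoint Q & Bad] ->
      #|U| <= 48 * #|Q| -> 8 * #|U| <= #|rcover Y1| -> 8 * #|U| <= #|rcover Y2| ->
      exists v a b, [/\ v \in Q, a \in rcover Y1 :\: U & b \in rcover Y2 :\: U] /\
        [/\ adj v a, adj v b & adj a b]) ->
  exists F : {set {set G}}, F \subset Y1 :|: Y2 /\ tileable (cover (X :|: F)).
Proof.
move=> fX fY dY dXY Xl l0 Yl MY1 MY2 XB Xsz link.
pose H (S : {set G}) : {set {set {set G}}} := [set e : {set {set G}} |
  [exists T1 in Y1, exists T2 in Y2,
     (e == [set T1; T2]) && tileable (S :|: T1 :|: T2)]].
have trXY : trivIset (X :|: (Y1 :|: Y2)).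
  by apply: trivIsetU; [exact: fX.1 | exact: fY.1 | ].
have XnY S : S \in X -> S \notin Y1 :|: Y2.
  move=> SX; apply/negP=> SY; have /flexible_gt0/card_gt0P[s sS] := fX.2 S SX.
  have /disjoint_setP/(_ s) := dXY; apply; by apply/bigcupP; exists S.
have [|S U SX S0 US|f [fH fd]] := @disjoint_choice_exists _ _ H 2 X.
- move=> S e SX; rewrite inE => /exists_inP[T1 _ /exists_inP[T2 _ /andP[/eqP-> _]]].
  by rewrite cards2; case: (_ != _).
- have fS := flexible_familyS SX fX; have rS := card_rcover fS.
  have Sl A : A \in S -> l <= #|A| <= #|cover S|.
    move=> AS; rewrite (Xl A (subsetP SX _ AS)) /=.
    by apply: subset_leq_card; apply: bigcup_sup.
  have /andP[cS _] := card_cover_bounds fS.1 Sl.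
  have fU : flexible_family (U :&: (Y1 :|: Y2)).
    by apply: flexible_familyS fY; apply: subsetIr.
  have Ul A : A \in U :&: (Y1 :|: Y2) -> 0 <= #|A| <= 4 * l.
    by case/setIP=> _ /Yl ->.
  have /andP[_ cU] := card_cover_bounds fU.1 Ul.
  have Usz : #|U :&: (Y1 :|: Y2)| <= 4 * #|S|.
    by apply: leq_trans US; apply: subset_leq_card; apply: subsetIl.
  have Ssz : #|S| * l <= 33 * M.
    by apply: leq_trans Xsz; rewrite leq_mul2r subset_leq_card ?orbT.
  have S1 : 0 < #|S| by rewrite card_gt0.
  (* At most [4 * s] sets with at most [4 * l] vertices each. *)
  have Ub : #|cover (U :&: (Y1 :|: Y2))| <= 16 * (#|S| * l).
    apply: leq_trans cU _; apply: leq_trans (leq_mul Usz (leqnn _)) _.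
    by rewrite mulnACA.
  have Sl0 : 0 < #|S| * l by rewrite muln_gt0 S1.
  have [|||||v [a [b [[vS aY bY] [va vb ab]]]]] :=
      link (rcover S) (cover (U :&: (Y1 :|: Y2))).
  + by move: rS cS Sl0; clear; rewrite ?/reverse_coercion; lia.
  + apply: disjointWl XB; apply: subset_trans (rcover_sub S) _; exact: coverS.
  + by move: rS cS Ub; clear; rewrite ?/reverse_coercion; lia.
  + by move: Ub Ssz MY1; clear; rewrite ?/reverse_coercion; lia.
  + by move: Ub Ssz MY2; clear; rewrite ?/reverse_coercion; lia.
  have /setDP[aY1 aU] := aY; have /setDP[bY2 bU] := bY.
  have [A AS vA] := rcoverP vS; have [T1 T1Y aT] := rcoverP aY1.
  have [T2 T2Y bT] := rcoverP bY2.
  have AX := subsetP SX _ AS.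
  have T1Y' : T1 \in Y1 :|: Y2 by rewrite inE T1Y.
  have T2Y' : T2 \in Y1 :|: Y2 by rewrite inE T2Y orbT.
  have notU T z : T \in Y1 :|: Y2 -> z \in removable T ->
      z \notin cover (U :&: (Y1 :|: Y2)) -> T \notin U.
    move=> TY zT; apply: contra => TU; apply/bigcupP; exists T.
      by rewrite inE TU.
    exact: subsetP (removable_sub T) _ zT.
  exists A, [set T1; T2]; split=> //.
    rewrite inE; apply/exists_inP; exists T1 => //; apply/exists_inP.
    exists T2 => //; rewrite eqxx /=.
    have dA T : T \in Y1 :|: Y2 -> [disjoint A & T].
      move=> TY; apply: (trivIsetP trXY).
      * by rewrite inE AX.
      * by rewrite inE TY orbT.
      * by apply: contraNneq (XnY _ AX) => ->.
    apply: (@tileable_join3 _ A T1 T2 v a b) => //; try exact: dA.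
    apply: (trivIsetP fY.1) => //; apply/eqP=> e12.
    by have /disjoint_setP/(_ T1 T1Y) := dY; rewrite e12; apply.
  apply/disjoint_setP=> T; rewrite !inE => /orP[]/eqP->; apply/negP.
    exact: notU T1Y' aT aU.
  exact: notU T2Y' bT bU.
have fY' S : S \in X -> f S \subset Y1 :|: Y2.
  move=> /fH; rewrite inE.
  case/exists_inP=> T1 T1Y /exists_inP[T2 T2Y /andP[/eqP-> _]].
  by rewrite subUset !sub1set !inE T1Y T2Y orbT.
exists (\bigcup_(S in X) f S); split; first by apply/bigcupsP.
have -> : X :|: \bigcup_(S in X) f S = \bigcup_(S in X) (S |: f S).
  apply/setP=> T; rewrite inE; apply/orP/bigcupP => [[TX|/bigcupP[S SX TS]]|[S SX]].
  - by exists T => //; rewrite !inE eqxx.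
  - by exists S => //; rewrite inE TS orbT.
  - by case/setU1P=> [->|TS]; [left | right; apply/bigcupP; exists S].
apply: (tileable_cover_bigcup trXY) => [S SX|S S' SX SX' nS|S SX].
- by rewrite subUset sub1set inE SX /= (subset_trans (fY' S SX)) // subsetUr.
- have /disjoint_setP dS := fd S S' SX SX' nS.
  apply/disjoint_setP=> T /setU1P[->|TS] /setU1P[|TS'].
  + by move/eqP; apply/negP.
  + by have := XnY S SX; rewrite (subsetP (fY' _ SX')).
  + by move=> TS'; have := XnY S' SX'; rewrite -TS' (subsetP (fY' _ SX)).
  + exact: dS TS TS'.
- have := fH S SX; rewrite inE.
  case/exists_inP=> T1 T1Y /exists_inP[T2 T2Y /andP[/eqP-> tS]].
  by rewrite !coverU !cover1 setUA.
Qed.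

(** * Absorbers *)

Lemma disjointUr (T : finType) (A B C : {set T}) :
  [disjoint A & B :|: C] = [disjoint A & B] && [disjoint A & C].
Proof. by rewrite -!setI_eq0 setIUr setU_eq0. Qed.

(** One level of the absorber: flexible sets of size between [2 * l] and [4
    * l] are placed outside the absorber [Q] for size [2 * l] and outside
    its exceptional set, so that whatever is left of the new level is a
    legitimate input for [Q].  The level covers about 26000 M vertices
    because each of its halves must have [4300 * M] removable ones, and
    these may be only a third of all. *)
Lemma absorber_halve (G : sgraph) (M d l : nat) (Z Q Bad : {set G}) :
  diamond_rich G M -> link_rich G M d -> 0 < l -> l < 3 * M ->
  absorber M (2 * l) Q Bad -> Q \subset Z ->
  #|Q| + #|Bad| + 27 * (1000 * M) <= #|Z| ->
  exists Q' Bad' : {set G}, [/\ Q' \subset Z, #|Q'| <= #|Q| + 27 * (1000 * M),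
    #|Bad'| <= d & absorber M l Q' Bad'].
Proof.
move=> dM lM l0 lM3 aQ QZ szZ; have M0 : 0 < M by lia.
have [||Y [fY YZ Yl /andP[Yge Yle]]] :=
  @exists_flexible_family G M (2 * l) (26 * (1000 * M)) (Z :\: (Q :|: Bad)) dM M0.
- by lia.
- have := cardsID (Q :|: Bad) Z; have := subset_leq_card (subsetIr Z (Q :|: Bad)).
  have := (leq_card_setU Q Bad).1.
  by lia.
have Yb S : S \in Y -> #|S| <= 4 * l by move=> /Yl /andP[_]; lia.
have [|Y1 [Y1Y MY1 Y1le]] := @flexible_family_split G Y (4300 * M) (4 * l) fY Yb.
  by lia.
pose Y2 := Y :\: Y1; have Y2Y : Y2 \subset Y by apply: subsetDl.
have YE : Y1 :|: Y2 = Y by apply: setUD.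
have MY2 : 4300 * M <= #|rcover Y2|.
  have := card_rcover (flexible_familyS Y2Y fY); rewrite /Y2.
  by lia.
have [Bad' [szBad' link]] := lM _ _ MY1 MY2.
have [YZ' dYQB] := subsetDP YZ; rewrite disjointUr in dYQB.
have /andP[dYQ dYB] := dYQB.
exists (Q :|: cover Y), Bad'; split=> //.
- by rewrite subUset QZ.
- by have := (leq_card_setU Q (cover Y)).1; lia.
move=> X fX Xl XB; rewrite disjointUr => /andP[XQ XY] Xsz X3.
have := @absorb_into_pairs G M l X Y1 Y2 Bad' fX.
rewrite YE => /(_ fY (disjointD _ _) XY Xl l0 Yb MY1 MY2 XB Xsz link) [F [FY tF]].
have trXY : trivIset (X :|: Y) by apply: trivIsetU; [exact: fX.1 | exact: fY.1 | ].
have YF : Y :\: F \subset Y by apply: subsetDl.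
have fYF := flexible_familyS YF fY.
have [R0 R0Y|R [RY]] :=
  @greedy_tiling G (fun P => #|cover P| < 9 * M + 8 * l) (Y :\: F) fYF.1.
  rewrite -leqNgt => szR0.
  apply: (@exists_tileable_triple G M (4 * l)) => //.
  - exact: flexible_familyS R0Y fYF.
  - by move=> S /(subsetP R0Y)/(subsetP YF)/Yb.
  - by move: szR0; clear; lia.
rewrite /= => szR tR.
have RYY : R \subset Y by apply: subset_trans YF.
have XF : X :|: F \subset X :|: Y by apply: setUS.
pose W1 := cover (X :|: F); pose W2 := cover (Y :\: F :\: R); pose W3 := cover R.
have dXYs : [disjoint X & Y].
  apply/disjoint_setP=> S SX SY; have /flexible_gt0/card_gt0P[s sS] := fX.2 S SX.
  by have /disjoint_setP/(_ s) := XY; apply; apply/bigcupP; exists S.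
have d1 (P : {set {set G}}) : P \subset Y :\: F -> [disjoint W1 & cover P].
  move=> PY; apply: (disjoint_cover trXY) => //.
    by apply: subset_trans PY _; apply: subset_trans YF _; apply: subsetUr.
  apply/disjoint_setP=> S SXF /(subsetP PY) /setDP[SY SF].
  case/setUP: SXF => [SX|]; last exact: negP.
  by have /disjoint_setP/(_ S SX SY) := dXYs.
have d12 : [disjoint W1 & W2] by apply: d1; apply: subsetDl.
have d13 : [disjoint W1 & W3] by apply: d1.
have d23 : [disjoint W2 & W3].
  by rewrite disjoint_sym; apply: (disjoint_cover fYF.1) => //;
     [apply: subsetDl | apply: disjointD].
have dQ (P : {set {set G}}) : P \subset X :|: Y -> [disjoint cover P & Q].
  move=> /coverS PXY; apply: disjointWl PXY _; rewrite coverU.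
  by rewrite disjoint_sym disjointUr !(disjoint_sym Q) XQ.
have dQ1 : [disjoint W1 & Q] by apply: dQ.
have dQ2 : [disjoint W2 & Q].
  by apply: dQ; rewrite !(subset_trans (subsetDl _ _)) ?subsetUr.
have dQ3 : [disjoint W3 & Q] by apply: dQ; apply: subset_trans RYY _; apply: subsetUr.
have EW : cover X :|: (Q :|: cover Y) = W1 :|: (W2 :|: (W3 :|: Q)).
  rewrite setUCA [RHS]setUA [RHS]setUA [RHS]setUC; congr (_ :|: _).
  rewrite /W1 /W2 /W3 -!coverU; congr cover.
  by rewrite -setUA [_ :\: R :|: R]setUC (setUD RY) -setUA (setUD FY).
rewrite EW in X3 *.
have d1' : [disjoint W1 & W2 :|: (W3 :|: Q)] by rewrite !disjointUr d12 d13.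
have d2' : [disjoint W2 & W3 :|: Q] by rewrite !disjointUr d23.
have W3Q : 3 %| #|W3 :|: Q|.
  move: X3; rewrite (card_disjointU d1') (card_disjointU d2').
  by rewrite (dvdn_addr _ (tileable_dvd3 tF)) (dvdn_addr _ (tileable_dvd3 tR)).
apply: tileableU => //; apply: tileableU => //; apply: aQ => //.
- exact: flexible_familyS RYY fY.
- by move=> S /(subsetP RYY)/Yl/andP[].
- by apply: disjointWl dYB; apply: coverS.
- have Rl S : S \in R -> 2 * l <= #|S| <= 4 * l.
    by move=> /(subsetP RYY) SY; rewrite Yb // andbT; case/andP: (Yl S SY).
  have /andP[+ _] := card_cover_bounds (flexible_familyS RYY fY).1 Rl.
  by move: szR lM3; clear; rewrite ?/reverse_coercion; lia.
Qed.

(** Each level doubles the size of the sets, so [k] levels suffice when [2 ^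
    k * l] reaches [3 * M]. *)
Lemma exists_absorber (G : sgraph) (M d k l : nat) (Z : {set G}) :
  diamond_rich G M -> link_rich G M d -> d <= M -> 0 < l -> 3 * M <= 2 ^ k * l ->
  k * (28 * (1000 * M)) <= #|Z| ->
  exists Q Bad : {set G}, [/\ Q \subset Z, #|Q| <= k * (28 * (1000 * M)),
    #|Bad| <= d & absorber M l Q Bad].
Proof.
move=> dM lM dleM; elim: k l => [|k IHk] l l0 kl szZ.
  exists set0, set0; rewrite sub0set !cards0; split=> //.
  by apply: absorber_large => //; rewrite expn0 mul1n in kl.
have [Ml|lM3] := leqP (3 * M) l.
  by exists set0, set0; rewrite sub0set !cards0; split=> //; apply: absorber_large.
have [|||Q [Bad [QZ szQ szBad aQ]]] := IHk (2 * l).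
- by rewrite muln_gt0.
- by rewrite mulnA -expnSr.
- by move: szZ; clear; lia.
have [|Q' [Bad' [Q'Z szQ' szBad' aQ']]] :=
  @absorber_halve G M d l Z Q Bad dM lM l0 lM3 aQ QZ.
  by move: szQ szBad szZ dleM; clear; lia.
exists Q', Bad'; split=> //.
by move: szQ szQ'; clear; lia.
Qed.

(** Disjoint triangles are chosen greedily: a triangle removes at most three
    vertices from every neighbourhood and decreases the number of vertices
    to be covered, so that an edge in the neighbourhood is always available. *)
Lemma tileable_covering (G : sgraph) (h : nat) (B W : {set G}) :
  (forall S : {set G}, h <= #|S| -> exists x y, [/\ x \in S, y \in S & adj x y]) ->
  (forall v, v \in B -> 3 * #|B| + h <= #|[set w in W | adj v w]|) ->
  exists T : {set G}, [/\ B \subset T, T \subset B :|: W, #|T| <= 3 * #|B| & tileable T].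
Proof.
move=> edge; have [k] := ubnP #|B|; elim: k B W => // k IHk B W.
rewrite ltnS => Bk deg.
have [->|/set0Pn[v vB]] := eqVneq B set0.
  by exists set0; rewrite !sub0set cards0 tileable0.
have [|x [y [+ + xy]]] := edge [set w in W | adj v w].
  by apply: leq_trans (deg v vB); apply: leq_addl.
rewrite !inE => /andP[xW vx] /andP[yW vy].
pose t := [set v; x; y]; have tt : tileable t by apply: tileable_triangle.
have t3 : #|t| <= 3.
  by rewrite /t setUC cardsU1 cards2; case: (_ \notin _); case: (_ != _).
have vt : v \in t by rewrite !inE eqxx.
have Bt : #|B :\: t| < #|B|.
  apply: proper_card; apply/properP; split; first exact: subsetDl.
  by exists v => //; rewrite inE vt.
have [||T [BT TBW Tsz tT]] := IHk (B :\: t) (W :\: t).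
- exact: leq_trans Bk.
- move=> u /setDP[uB _].
  have := deg u uB.
  rewrite -(cardsID t [set w in W | adj u w]).
  have := subset_leq_card (subsetIr [set w in W | adj u w] t).
  have -> : [set w in W | adj u w] :\: t = [set w in W :\: t | adj u w].
    by apply/setP=> w; rewrite !inE andbA.
  by move: t3 Bt; clear; lia.
have dt : [disjoint t & T].
  apply: disjointWr TBW _; rewrite disjointUr.
  by rewrite !disjointD.
exists (t :|: T); split.
- apply/subsetP=> u uB; rewrite inE; case: (boolP (u \in t)) => // ut.
  by rewrite (subsetP BT) // inE ut.
- rewrite !subUset !sub1set !inE vB xW yW !orbT /=.
  apply: subset_trans TBW _; apply: setUSS; exact: subsetDl.
- by rewrite card_disjointU //; move: Tsz t3 Bt; clear; lia.
- exact: tileableU.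
Qed.

(** * Tiling a graph that is rich in diamonds and links *)

(** The reserved set [W] comes first: the vertices [D] that are sparse into
    it are covered by triangles at once, with the help of the minimum
    degree.  Then an absorber is built outside [W], and its exceptional
    vertices are covered by triangles whose other vertices lie in [W].  All
    remaining vertices are tiled greedily, and the leftover is absorbed. *)
Theorem tileable_of_rich (G : sgraph) (M d h k : nat) (W D : {set G}) :
  0 < M -> d <= M -> diamond_rich G M -> link_rich G M d ->
  (forall S : {set G}, h <= #|S| -> exists x y, [/\ x \in S, y \in S & adj x y]) ->
  (forall v : G, 3 * d + h <= degree v) ->
  #|D| <= d -> (forall v, v \notin D -> 6 * d + h <= #|[set w in W | adj v w]|) ->
  3 * M <= 2 ^ k -> k * (28 * (1000 * M)) + #|W| + 3 * d <= #|G| ->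
  3 %| #|G| -> tileable [set: G].
Proof.
move=> M0 dM rM lM edge deg szD degW Mk szG G3.
have [v vD|T0 [DT0 _ szT0 tT0]] := @tileable_covering G h D setT edge.
  have -> : [set w in setT | adj v w] = [set w | adj v w].
    by apply/setP=> w; rewrite !inE.
  by have := deg v; rewrite /degree; move: szD; clear; lia.
have [||Q [Bad [QZ szQ szBad aQ]]] :=
    @exists_absorber G M d k 1 (~: (W :|: T0)) rM lM dM isT.
- by rewrite muln1.
- have := cardsC (W :|: T0); have := (leq_card_setU W T0).1.
  by move: szG szT0 szD; clear; lia.
have QW x : x \in Q -> x \notin W /\ x \notin T0.
  by move/(subsetP QZ); rewrite !inE negb_or => /andP.
pose B1 := Bad :\: (Q :|: T0).
have szB1 : #|B1| <= d by apply: leq_trans szBad; rewrite subset_leq_card // subsetDl.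
have [v|T1 [BT1 T1BW szT1 tT1]] := @tileable_covering G h B1 (W :\: T0) edge.
  rewrite !inE negb_or -andbA => /and3P[_ vT0 _].
  have vD : v \notin D by apply: contra vT0; apply: (subsetP DT0).
  have := degW v vD; rewrite -(cardsID T0 [set w in W | adj v w]).
  have := subset_leq_card (subsetIr [set w in W | adj v w] T0).
  have -> : [set w in W | adj v w] :\: T0 = [set w in W :\: T0 | adj v w].
    by apply/setP=> w; rewrite !inE andbA.
  by move: szB1 szT0 szD; clear; lia.
have T1x x : x \in T1 -> x \notin T0 /\ x \notin Q.
  move/(subsetP T1BW); rewrite !inE negb_or.
  case/orP=> [/andP[/andP[-> ->]] //|/andP[-> xW]]; split=> //.
  by apply/negP=> /QW[]; rewrite xW.
pose P := singletons (~: (T0 :|: T1 :|: Q)).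
have fP : flexible_family P by apply: flexible_family_singletons.
have P1 S : S \in P -> #|S| = 1 by case/imsetP=> v _ ->; rewrite cards1.
have [R0 R0P|R [RP /= szR tR]] :=
  @greedy_tiling G (fun R => #|cover R| < 9 * M + 2) P fP.1.
  rewrite -leqNgt => szR0.
  apply: (@exists_tileable_triple G M 1) => //.
    exact: flexible_familyS R0P fP.
  by move=> S /(subsetP R0P)/P1 ->.
have coverP : cover P = ~: (T0 :|: T1 :|: Q) by apply: cover_singletons.
have sub (P' : {set {set G}}) x : P' \subset P -> x \in cover P' ->
    [/\ x \notin T0, x \notin T1 & x \notin Q].
  move=> /coverS/subsetP cP /cP; rewrite coverP !inE !negb_or.
  by case/andP=> /andP[].
have fR := flexible_familyS RP fP.
pose A := T0 :|: T1 :|: cover (P :\: R).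
have tA : tileable A.
  apply: tileableU => //; last apply: tileableU => //.
    apply/disjoint_setP=> x /setUP[xT|xT] /(sub _ x (subsetDl _ _))[];
    by rewrite xT.
  by apply/disjoint_setP=> x x0 /T1x[]; rewrite x0.
have dA : [disjoint A & cover R :|: Q].
  apply/disjoint_setP=> x xA /setUP[xR|xQ].
    have [x0 x1 _] := sub R x RP xR.
    move: xA; rewrite !in_setU (negPf x0) (negPf x1) /=.
    have := disjoint_cover fP.1 RP (subsetDl P R) (disjointD R P).
    by move/disjoint_setP/(_ x xR).
  have [_ x0] := QW x xQ.
  move: xA; rewrite !in_setU (negPf x0) /= => /orP[/T1x[_]|].
    by rewrite xQ.
  by case/(sub _ x (subsetDl _ _)); rewrite xQ.
have EA : [set: G] = A :|: (cover R :|: Q).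
  apply/esym/eqP; rewrite -subTset; apply/subsetP=> x _.
  have [xP|] := boolP (x \in cover P); last first.
    by rewrite coverP !inE negbK => /orP[/orP[]|] ->; rewrite ?orbT.
  by move: xP; rewrite -{1}(setUD RP) coverU !in_setU => /orP[]->; rewrite ?orbT.
rewrite EA; apply: tileableU => //; apply: aQ => //.
- by move=> S /(subsetP RP)/P1 ->.
- apply/disjoint_setP=> x /(sub R x RP)[x0 x1 xQ] xB; move/negP: x1; apply.
  by apply: (subsetP BT1); rewrite !inE negb_or xQ x0.
- by apply/disjoint_setP=> x /(sub R x RP)[_ _ /negP].
- rewrite muln1; have R1 S : S \in R -> 1 <= #|S| <= 1 by move/(subsetP RP)/P1 ->.
  have /andP[+ _] := card_cover_bounds fR.1 R1.
  by move: szR M0; clear; rewrite ?/reverse_coercion; lia.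
- by rewrite -(dvdn_addr _ (tileable_dvd3 tA)) -(card_disjointU dA) -EA cardsT.
Qed.

(** * Edges counted by degrees *)

Local Open Scope ring_scope.

Definition degree_in (G : sgraph) (v : G) (Y : {set G}) : nat :=
  #|[set w in Y | adj v w]|.

Lemma set2_eq (T : finType) (a b x y : T) :
  a != b ->
  ([set x; y] == [set a; b]) = ((x, y) == (a, b)) || ((x, y) == (b, a)).
Proof.
move=> ab; rewrite !xpair_eqE; apply/eqP/orP; last first.
  by case=> /andP[/eqP-> /eqP->] //; rewrite setUC.
move=> /setP E; have := E a; have := E b; have := E x.
rewrite !inE !eqxx ?orbT /= => /esym/orP[/eqP xa|/eqP xb] Eb Ea.
  move: Eb; rewrite xa eq_sym (negPf ab) /= => /eqP by_; left.
  by rewrite -by_ !eqxx.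
move: Ea; rewrite xb (negPf ab) /= => /eqP ay; right.
by rewrite -ay !eqxx.
Qed.

(** Both sides count the ordered pairs [(x, y)] of adjacent vertices in [X]
    times [Y]: an edge joining [X] to [Y] comes from two such pairs if both
    of its endpoints lie in both sets, and from one pair otherwise. *)
Lemma edges_betweenE (G : sgraph) (X Y : {set G}) :
  edges_between X Y = (\sum_(x in X) degree_in x Y)%N.
Proof.
pose ends (u : G * G) : {set G} := [set u.1; u.2].
pose pairs := [set u : G * G | (u.1 \in X) && ((u.2 \in Y) && adj u.1 u.2)].
transitivity #|pairs|; last first.
  rewrite -sum1_card (eq_bigl (fun u : G * G =>
    (u.1 \in X) && ((u.2 \in Y) && adj u.1 u.2))); last by move=> u; rewrite inE.
  rewrite -(pair_big_dep (mem X) (fun x y => (y \in Y) && adj x y)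
    (fun _ _ => 1%N)) /=.
  apply: eq_bigr => x _; rewrite /degree_in -sum1_card.
  by apply: eq_bigl => y; rewrite inE.
have fiber f : f \in edges G ->
    #|[set u in pairs | ends u == f]| = ((joins X Y f) + (f \subset X :&: Y))%N.
  case/imsetP=> -[a b]; rewrite inE /= => ab ->; have nab := adj_neq ab.
  have -> : [set u in pairs | ends u == [set a; b]] =
      [set u in pairs | (u == (a, b)) || (u == (b, a))].
    by apply/setP=> -[x y]; rewrite !inE set2_eq.
  have -> : #|[set u in pairs | (u == (a, b)) || (u == (b, a))]| =
      (((a \in X) && (b \in Y)) + ((b \in X) && (a \in Y)))%N.
    rewrite (cardsD1 (a, b)) (cardsD1 (b, a)) !inE /= !eqxx !xpair_eqE.
    rewrite (negPf nab) (eq_sym b a) (negPf nab) /= ab adj_sym ab !andbT.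
    rewrite -[X in _ = X]addn0 -addnA; congr (_ + (_ + _))%N.
    apply/eqP; rewrite cards_eq0; apply/eqP/setP=> u; rewrite !inE.
    by case: (u == (b, a)) => //=; case: (u == (a, b)) => //=; rewrite andbF.
  have -> : joins X Y [set a; b] = ((a \in X) && (b \in Y)) || ((b \in X) && (a \in Y)).
    apply/exists_inP/orP => [[x xX /exists_inP[y yY]]|].
      rewrite eq_sym set2_eq // !xpair_eqE.
      by case/orP=> /andP[/eqP<- /eqP<-]; [left | right]; rewrite xX yY.
    case=> /andP[xX yY]; [exists a => // | exists b => //]; apply/exists_inP.
      by exists b.
    by exists a => //; rewrite setUC.
  rewrite subUset !sub1set !inE.
  by case: (a \in X); case: (b \in X); case: (a \in Y); case: (b \in Y).
have -> : #|pairs| = (\sum_(f in edges G) #|[set u in pairs | ends u == f]|)%N.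
  rewrite -sum1_card (partition_big ends (mem (edges G))) /=; last first.
    move=> u; rewrite inE => /andP[_ /andP[_ uv]].
    by apply/imsetP; exists u => //; rewrite inE.
  apply: eq_bigr => f _; rewrite -sum1_card.
  by apply: eq_bigl => u; rewrite !inE.
rewrite (eq_bigr _ fiber) big_split /= /edges_between -!sum1_card.
by congr (_ + _)%N; rewrite -big_mkcondr; apply: eq_bigl => f; rewrite inE.
Qed.

Lemma min_degree_le (G : sgraph) (v : G) : (min_degree G <= degree v)%N.
Proof.
rewrite /min_degree; have := mem_index_enum v.
elim: (index_enum G) => // u s IHs; rewrite big_cons inE.
case/orP=> [/eqP->|/IHs le]; first exact: geq_minl.
exact: leq_trans (geq_minr _ _) le.
Qed.

(** * Consequences of jumbledness *)

(** Squaring removes the square root from jumbledness, so that the following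
    arguments take place in an ordered field; [mu * p ^+ 2] is the
    jumbledness parameter. *)
Definition square_jumbled (R : realFieldType) (G : sgraph) (p mu : R) : Prop :=
  forall X Y : {set G},
    ((\sum_(x in X) degree_in x Y)%N%:R - #|X|%:R * #|Y|%:R * p) ^+ 2
      <= (mu * p ^+ 2) ^+ 2 * (#|X|%:R * #|Y|%:R).

Lemma bijumbled_square (R : realType) (G : sgraph) (p mu : R) :
  bijumbled G p (mu * p ^+ 2) -> square_jumbled G p mu.
Proof.
case=> _ b0 J X Y; have := J X Y; rewrite edges_betweenE.
rewrite -(ler_pXn2r (_ : (0 < 2)%N)) ?nnegrE ?normr_ge0 //; last first.
  by rewrite mulr_ge0 ?sqrtr_ge0 // ltW.
by rewrite real_normK ?num_real // exprMn sqr_sqrtr // mulr_ge0 ?ler0n.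
Qed.

Lemma sum_degree_in_le (R : realFieldType) (G : sgraph) (X Y : {set G}) (t : R) :
  (forall v, v \in X -> (degree_in v Y)%:R <= t) ->
  (\sum_(x in X) degree_in x Y)%N%:R <= #|X|%:R * t.
Proof.
move=> le_t; rewrite natr_sum mulr_natl -sumr_const.
by apply: ler_sum => v /le_t.
Qed.

Lemma sum_degree_in_ge (R : realFieldType) (G : sgraph) (X Y : {set G}) (t : R) :
  (forall v, v \in X -> t <= (degree_in v Y)%:R) ->
  #|X|%:R * t <= (\sum_(x in X) degree_in x Y)%N%:R.
Proof.
move=> ge_t; rewrite natr_sum mulr_natl -sumr_const.
by apply: ler_sum => v /ge_t.
Qed.

(** If on average each vertex of [X] has at least [p * s] neighbours too
    many or too few in [Y], then [X] is small.  All later uses of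
    jumbledness are special cases. *)
Lemma deviation_bound (R : realFieldType) (G : sgraph) (p mu s : R)
    (X Y : {set G}) :
  square_jumbled G p mu -> 0 < p -> 0 <= s ->
  #|X|%:R * (p * s) <=
    `|(\sum_(x in X) degree_in x Y)%N%:R - #|X|%:R * #|Y|%:R * p| ->
  #|X|%:R * s ^+ 2 <= (mu * p) ^+ 2 * #|Y|%:R.
Proof.
move=> J p0 s0 dev; have [->|X0] := eqVneq #|X| 0%N.
  by rewrite mul0r mulr_ge0 ?sqr_ge0 ?ler0n.
have x0 : 0 < #|X|%:R :> R by rewrite ltr0n lt0n.
have xp0 : 0 < #|X|%:R * p ^+ 2 by rewrite mulr_gt0 ?exprn_gt0.
rewrite -(ler_pM2l xp0).
have -> : #|X|%:R * p ^+ 2 * (#|X|%:R * s ^+ 2) = (#|X|%:R * (p * s)) ^+ 2 by ring.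
have -> : #|X|%:R * p ^+ 2 * ((mu * p) ^+ 2 * #|Y|%:R) =
    (mu * p ^+ 2) ^+ 2 * (#|X|%:R * #|Y|%:R) by ring.
apply: le_trans (J X Y); rewrite -[leRHS]real_normK ?num_real //.
by rewrite ler_pXn2r ?nnegrE ?normr_ge0 // !mulr_ge0 // ltW.
Qed.

Definition sparse_into (R : realFieldType) (G : sgraph) (p : R) (Y : {set G}) :
    {set G} :=
  [set v | (degree_in v Y)%:R < p * #|Y|%:R / 2].

Lemma card_sparse_into (R : realFieldType) (G : sgraph) (p mu : R) (Y : {set G}) :
  square_jumbled G p mu -> 0 < p ->
  #|sparse_into p Y|%:R * #|Y|%:R <= 4 * (mu * p) ^+ 2.
Proof.
move=> J p0; have [->|Y0] := eqVneq #|Y| 0%N.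
  by rewrite mulr0 mulr_ge0 ?sqr_ge0.
have y0 : 0 < #|Y|%:R :> R by rewrite ltr0n lt0n.
have := @deviation_bound R G p mu (#|Y|%:R / 2) (sparse_into p Y) Y J p0 _ _.
have -> : #|sparse_into p Y|%:R * (#|Y|%:R / 2) ^+ 2 =
    #|sparse_into p Y|%:R * #|Y|%:R / 4 * #|Y|%:R :> R by field.
rewrite ler_pM2r // ler_pdivrMr // [_ * 4]mulrC; apply.
  by rewrite divr_ge0.
rewrite distrC; apply: le_trans (ler_norm _).
have : (\sum_(x in sparse_into p Y) degree_in x Y)%N%:R <=
    #|sparse_into p Y|%:R * (p * #|Y|%:R / 2) :> R.
  by apply: sum_degree_in_le => v; rewrite inE => /ltW.
lra.
Qed.

Lemma no_edges_between (R : realFieldType) (G : sgraph) (p mu : R)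
    (X Y : {set G}) :
  square_jumbled G p mu -> 0 < p ->
  (forall x y, x \in X -> y \in Y -> ~~ adj x y) ->
  #|X|%:R * #|Y|%:R <= (mu * p) ^+ 2.
Proof.
move=> J p0 noXY; have [->|Y0] := eqVneq #|Y| 0%N.
  by rewrite mulr0 sqr_ge0.
have y0 : 0 < #|Y|%:R :> R by rewrite ltr0n lt0n.
have := @deviation_bound R G p mu #|Y|%:R X Y J p0 (ltW y0).
have -> : #|X|%:R * #|Y|%:R ^+ 2 = #|X|%:R * #|Y|%:R * #|Y|%:R :> R by ring.
rewrite ler_pM2r //; apply.
rewrite distrC; apply: le_trans (ler_norm _).
have -> : (\sum_(x in X) degree_in x Y)%N = 0%N.
  apply: big1 => x xX; apply/eqP; rewrite cards_eq0; apply/eqP/setP=> y.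
  by rewrite !inE; apply/negP=> /andP[yY]; apply/negP/noXY.
by rewrite subr0 mulrCA mulrC -mulrA.
Qed.

Lemma exists_edge (R : realFieldType) (G : sgraph) (p mu : R) (X Y : {set G}) :
  square_jumbled G p mu -> 0 < p ->
  (mu * p) ^+ 2 < #|X|%:R * #|Y|%:R ->
  exists x y, [/\ x \in X, y \in Y & adj x y].
Proof.
move=> J p0 big.
have [/exists_inP[x xX /exists_inP[y yY xy]]|no] :=
  boolP [exists x in X, exists y in Y, adj x y]; first by exists x, y.
have := no_edges_between J p0 _ => /(_ X Y); rewrite leNgt big; case/(_ _)/negP => //.
move=> x y xX yY; apply: contra no => xy.
by apply/exists_inP; exists x => //; apply/exists_inP; exists y.
Qed.

(** Few vertices have as many as [p * a / 4] neighbours in a set with at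
    most [a / 8] vertices, since that is at least twice the expected number. *)
Lemma card_concentrated (R : realFieldType) (G : sgraph) (p mu a : R)
    (X U : {set G}) :
  square_jumbled G p mu -> 0 < p -> 0 <= a -> 8 * #|U|%:R <= a ->
  (forall v, v \in X -> p * a / 4 <= (degree_in v U)%:R) ->
  #|X|%:R * a ^+ 2 <= 64 * (mu * p) ^+ 2 * #|U|%:R.
Proof.
move=> J p0 a0 Ua Xa.
have := @deviation_bound R G p mu (a / 8) X U J p0.
have -> : #|X|%:R * (a / 8) ^+ 2 = #|X|%:R * a ^+ 2 / 64 by field.
rewrite ler_pdivrMr // [_ * 64]mulrC !mulrA; apply; first by lra.
apply: le_trans (ler_norm _); apply: (@le_trans _ _ (#|X|%:R * (p * a / 4) - #|X|%:R * #|U|%:R * p)).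
  have xp0 : 0 <= #|X|%:R * p by rewrite mulr_ge0 // ltW.
  have := ler_wpM2l xp0 Ua; lra.
by rewrite lerB // sum_degree_in_ge.
Qed.

(** * Jumbled graphs are rich in diamonds and links *)

Lemma card_sparse_into_le (R : realFieldType) (G : sgraph) (p mu K : R)
    (Y : {set G}) :
  square_jumbled G p mu -> 0 < p -> 0 < mu -> K * (4 * mu) <= #|Y|%:R ->
  K * #|sparse_into p Y|%:R <= mu * p ^+ 2.
Proof.
move=> J p0 mu0 KY; have := card_sparse_into Y J p0; set b := #|sparse_into p Y|%:R.
move=> bY; have b0 : 0 <= b by rewrite ler0n.
rewrite -(ler_pM2l (_ : 0 < 4 * mu)); last by rewrite mulr_gt0.
apply: le_trans (_ : b * #|Y|%:R <= _); last by apply: le_trans bY _; lra.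
have := ler_wpM2l b0 KY; lra.
Qed.

Lemma exists_outside (R : realFieldType) (T : finType) (X B : {set T}) :
  #|B|%:R < #|X|%:R :> R -> exists2 x, x \in X & x \notin B.
Proof.
rewrite ltr_nat => BX; apply/subsetPn; apply: contraL BX => XB.
by rewrite -leqNgt subset_leq_card.
Qed.

Lemma card_setU_le (R : realFieldType) (T : finType) (A B : {set T}) :
  #|A :|: B|%:R <= #|A|%:R + #|B|%:R :> R.
Proof. by rewrite -natrD ler_nat; apply: (leq_card_setU A B).1. Qed.

Definition neighbours_in (G : sgraph) (v : G) (Y : {set G}) : {set G} :=
  [set w in Y | adj v w].

Lemma notin_sparse_into (R : realFieldType) (G : sgraph) (p : R) (Y : {set G})
    (v : G) :
  v \notin sparse_into p Y -> p * #|Y|%:R / 2 <= #|neighbours_in v Y|%:R.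
Proof. by rewrite inE -leNgt. Qed.

(** A vertex [x] that is not sparse into [D], [Y] and [W] exists because
    fewer than [4 * mu] vertices are.  Its neighbourhoods in these sets have
    more than [2 * mu * p] vertices.  Choosing the middle edge of the
    diamond from [x] is essential here: at most [mu * p / 2] of its
    neighbours in [Y] have no neighbour in a set of that size, so some [y]
    among them is adjacent to neighbours of [x] in both [D] and [W]. *)
Lemma square_jumbled_diamond_rich (R : realFieldType) (G : sgraph) (p mu : R)
    (M : nat) :
  square_jumbled G p mu -> 0 < p -> p <= 1 -> 0 < mu -> 4 * mu < M%:R ->
  diamond_rich G M.
Proof.
move=> J p0 p1 mu0 muM D X Y W MD MX MY MW.
have big (S : {set G}) : (M <= #|S|)%N -> 4 * mu < #|S|%:R.
  by move=> MS; apply: lt_le_trans muM _; rewrite ler_nat.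
have mup0 : 0 < mu * p by rewrite mulr_gt0.
have few (S : {set G}) : (M <= #|S|)%N -> #|sparse_into p S|%:R <= mu.
  move=> /big /ltW; rewrite -[4 * mu]mul1r => /(card_sparse_into_le J p0 mu0).
  rewrite mul1r => /le_trans; apply; apply: ler_piMr; first exact: ltW.
  by apply: exprn_ile1 => //; apply: ltW.
have [|x xX] :=
  @exists_outside R _ X (sparse_into p D :|: sparse_into p Y :|: sparse_into p W).
  apply: le_lt_trans (big X MX); apply: le_trans (card_setU_le _ _ _) _.
  have := card_setU_le R (sparse_into p D) (sparse_into p Y).
  have := few D MD; have := few Y MY; have := few W MW; lra.
rewrite !in_setU !negb_or => /andP[/andP[/notin_sparse_into xD /notin_sparse_into xY]].
move/notin_sparse_into => xW.
have bignb (S : {set G}) : (M <= #|S|)%N ->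
    p * #|S|%:R / 2 <= #|neighbours_in x S|%:R -> 2 * (mu * p) < #|neighbours_in x S|%:R.
  move=> /big MS; apply: lt_le_trans.
  by have := MS; rewrite -(ltr_pM2l p0); lra.
have {}xD := bignb D MD xD; have {}xY := bignb Y MY xY; have {}xW := bignb W MW xW.
pose isolated (S : {set G}) := [set y in neighbours_in x Y |
  [forall z in neighbours_in x S, ~~ adj y z]].
have few_isolated (S : {set G}) : 2 * (mu * p) < #|neighbours_in x S|%:R ->
    #|isolated S|%:R <= mu * p / 2.
  move=> xS; have : #|isolated S|%:R * #|neighbours_in x S|%:R <= (mu * p) ^+ 2.
    apply: no_edges_between => // y z; rewrite inE => /andP[_ /forall_inP]; exact.
  have := ler_wpM2l (ler0n R #|isolated S|) (ltW xS) => le1 le2.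
  rewrite -(ler_pM2l mup0); lra.
have [|y yY] := @exists_outside R _ (neighbours_in x Y) (isolated D :|: isolated W).
  apply: le_lt_trans xY; apply: le_trans (card_setU_le _ _ _) _.
  have := few_isolated D xD; have := few_isolated W xW; lra.
rewrite in_setU negb_or ![y \in isolated _]inE yY /=.
case/andP=> /forall_inPn[v vD] /negPn yv /forall_inPn[w wW] /negPn yw.
move: yY vD wW; rewrite !inE => /andP[yY xy] /andP[vD xv] /andP[wW xw].
by exists v, x, y, w.
Qed.

Lemma neighbours_in_avoid (G : sgraph) (v : G) (A U : {set G}) :
  (degree_in v A <= degree_in v (A :&: U) + #|neighbours_in v (A :\: U)|)%N.
Proof.
rewrite /degree_in -(cardsID U [set w in A | adj v w]) leq_add //.
  by apply: subset_leq_card; apply/subsetP=> w; rewrite !inE -!andbA andbCA andbC -andbA.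
by apply: subset_leq_card; apply/subsetP=> w; rewrite !inE andbA.
Qed.

(** The exceptional vertices are those that are sparse into [A] or [B].  If
    a vertex of [Q] is neither exceptional nor concentrated on [U], then it
    keeps enough neighbours in both [A :\: U] and [B :\: U] for an edge
    between them.  Since [U] is at most 48 times as large as [Q], fewer than
    half of the vertices of [Q] are concentrated on [U] within [A], and
    likewise for [B]. *)
Lemma square_jumbled_link_rich (R : realFieldType) (G : sgraph) (p mu : R)
    (M d : nat) :
  square_jumbled G p mu -> 0 < p -> p <= 1 -> 0 < mu -> 4 * mu < M%:R ->
  (forall m : nat, m%:R <= mu * p ^+ 2 -> (m <= d)%N) ->
  link_rich G M d.
Proof.
move=> J p0 p1 mu0 muM dP A B MA MB.
have mup0 : 0 < mu * p by rewrite mulr_gt0.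
have big (S : {set G}) : (4300 * M <= #|S|)%N -> 100 * mu < #|S|%:R.
  by rewrite -(ler_nat R) natrM => MS; lra.
have {MA}A_big := big A MA; have {MB}B_big := big B MB.
have few (S : {set G}) : 100 * mu < #|S|%:R ->
    2 * #|sparse_into p S|%:R <= mu * p ^+ 2.
  by move=> S_big; apply: card_sparse_into_le => //; lra.
exists (sparse_into p A :|: sparse_into p B); split.
  apply: dP; apply: le_trans (card_setU_le _ _ _) _.
  have := few A A_big; have := few B B_big; lra.
move=> Q U Q0 dQ UQ UA UB.
pose conc (S : {set G}) :=
  [set v in Q | p * #|S|%:R / 4 <= (degree_in v (S :&: U))%:R].
have few_conc (S : {set G}) : 100 * mu < #|S|%:R -> (8 * #|U| <= #|S|)%N ->
    2 * #|conc S|%:R < #|Q|%:R :> R.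
  move=> S_big US.
  have SU : (#|S :&: U| <= #|U|)%N by apply: subset_leq_card; apply: subsetIr.
  have USR : 8 * #|S :&: U|%:R <= #|S|%:R :> R.
    by rewrite -natrM ler_nat; apply: leq_trans US; rewrite leq_mul2l.
  have := @card_concentrated R G p mu #|S|%:R (conc S) (S :&: U) J p0 (ler0n _ _) USR.
  move=> /(_ _) c1.
  have {c1} c1 : #|conc S|%:R * #|S|%:R ^+ 2 <= 64 * (mu * p) ^+ 2 * #|S :&: U|%:R.
    by apply: c1 => v; rewrite inE => /andP[].
  have UQR : #|S :&: U|%:R <= 48 * #|Q|%:R :> R.
    by rewrite -natrM ler_nat; apply: leq_trans UQ.
  have q0 : 0 < #|Q|%:R :> R by rewrite ltr0n.
  have mup2 : (mu * p) ^+ 2 <= mu ^+ 2.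
    rewrite exprMn; apply: ler_piMr; first exact: sqr_ge0.
    by apply: exprn_ile1 => //; apply: ltW.
  have mu20 : 0 < mu ^+ 2 by rewrite exprn_gt0.
  have S2 : (100 * 100) * mu ^+ 2 <= #|S|%:R ^+ 2.
    apply: le_trans (_ : (100 * mu) ^+ 2 <= _).
      by rewrite exprMn; apply: ler_wpM2r; [exact: ltW | rewrite expr2].
    by rewrite ler_pXn2r ?nnegrE ?ler0n ?mulr_ge0 ?ltW.
  have c2 : #|conc S|%:R * ((100 * 100) * mu ^+ 2) <= 64 * mu ^+ 2 * (48 * #|Q|%:R).
    apply: le_trans (ler_wpM2l (ler0n _ _) S2) _; apply: le_trans c1 _.
    by apply: ler_pM => //; [rewrite mulr_ge0 ?sqr_ge0 | lra].
  have c3 : mu ^+ 2 * (#|conc S|%:R * (100 * 100)) <= mu ^+ 2 * (64 * 48 * #|Q|%:R) by lra.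
  by move: c3; rewrite ler_pM2l // => c3; lra.
have [|v vQ] := @exists_outside R _ Q (conc A :|: conc B).
  apply: le_lt_trans (card_setU_le _ _ _) _.
  have := few_conc A A_big UA; have := few_conc B B_big UB; lra.
rewrite in_setU negb_or !inE vQ /= -!ltNge => /andP[cA cB].
have vbad : v \notin sparse_into p A :|: sparse_into p B.
  by apply/negP=> vb; have /disjoint_setP/(_ v vQ vb) := dQ.
rewrite in_setU negb_or !inE -!leNgt in vbad; case/andP: vbad => gA gB.
have rest (S : {set G}) : 100 * mu < #|S|%:R ->
    (degree_in v (S :&: U))%:R < p * #|S|%:R / 4 ->
    p * #|S|%:R / 2 <= (degree_in v S)%:R ->
    mu * p < #|neighbours_in v (S :\: U)|%:R.
  move=> S_big cS gS; have := neighbours_in_avoid v S U.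
  rewrite -(ler_nat R) natrD => le1.
  have := S_big; rewrite -(ltr_pM2l p0); lra.
have {gA cA} nA := rest A A_big cA gA; have {gB cB} nB := rest B B_big cB gB.
have [|a [b [+ + ab]]] := @exists_edge R G p mu (neighbours_in v (A :\: U))
    (neighbours_in v (B :\: U)) J p0.
  by rewrite expr2; apply: ltr_pM => //; apply: ltW.
by rewrite !inE => /andP[aA va] /andP[bB vb]; exists v, a, b; rewrite !inE.
Qed.

(** * Numerical bounds and the theorem *)

Lemma half_le_ln2 (R : realType) : 2^-1 <= ln (2 : R).
Proof.
have := expR_ge1Dx (- ln (2 : R)); rewrite expRN lnK ?posrE //; lra.
Qed.

(** The factor 2 comes from the bound [1 / 2 <= ln 2]. *)
Lemma exponent_le_ln (R : realType) (s n : nat) :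
  (2 ^ s <= n)%N -> s%:R <= 2 * ln (n%:R : R).
Proof.
move=> sn; have n0 : (0 < n)%N by apply: leq_trans sn; rewrite expn_gt0.
have : ln ((2 : R) ^+ s) <= ln n%:R.
  by rewrite ler_ln ?posrE ?exprn_gt0 ?ltr0n // -natrX ler_nat.
rewrite lnXn // -[ln 2 *+ s]mulr_natl; have := ler_wpM2l (ler0n R s) (half_le_ln2 R); lra.
Qed.

Unset Implicit Arguments.

Theorem theorem1p2 (R : realType) :
  exists eps : R, 0 < eps /\
    forall (n : nat) (p : R) (G : sgraph),
      (0 < n)%N -> (3 %| n)%N -> 0 <= p <= 1 -> #|G| = n ->
      bijumbled G p (eps * n%:R * p ^+ 2 / ln n%:R) ->
      n%:R * p / 2%:R <= (min_degree G)%:R ->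
      exists F : {set {set G}}, triangle_factor F.
Proof.
(* The absorber has at most [4 * ln n] levels with at most [28000 * M] vertices
   each, and [M <= 5 * mu]; with this [e] it takes at most [0.56 * n]
   vertices. *)
have [e e0 eE] : exists2 e : R, 0 < e & e * (1000 * 1000) = 1.
  have c0 : 0 < 1000 * 1000 :> R by rewrite mulr_gt0.
  by exists (1000 * 1000)^-1; rewrite ?invr_gt0 // mulVf // gt_eqF.
exists e; split=> // n p G n0 n3 /andP[p0 p1] Gn J degG.
apply: tileable_setT_factor.
have n_ge3 : (3 <= n)%N by apply: dvdn_leq.
have nR3 : 3 <= n%:R :> R by rewrite ler_nat.
pose L : R := ln n%:R; pose mu := e * n%:R / L.
have L_half : 2^-1 <= L.
  by apply: le_trans (half_le_ln2 R) _; rewrite ler_ln ?posrE //; lra.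
have L0 : 0 < L by lra.
have muL : mu * L = e * n%:R by rewrite /mu divfK // gt_eqF.
have mu0 : 0 < mu by rewrite divr_gt0 // mulr_gt0 //; lra.
have {}p0 : 0 < p.
  rewrite lt_def p0 andbT; apply/eqP=> pz; case: J => _.
  by rewrite pz expr0n /= mulr0 mul0r ltxx.
have {}J : square_jumbled G p mu.
  by apply: bijumbled_square; move: J; rewrite -/L /mu [X in bijumbled _ _ X]mulrAC.
have mu_n : mu <= 2 * (e * n%:R).
  have := ler_wpM2l (ltW mu0) L_half; lra.
have enE : e * n%:R * (1000 * 1000) = n%:R by rewrite mulrAC eE mul1r.
have mup0 : 0 < mu * p by rewrite mulr_gt0.
have mup1 : 1 <= mu * p.
  have /card_gt0P[v _] : (0 < #|G|)%N by rewrite Gn.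
  have := @no_edges_between R G p mu [set v] [set v] J p0.
  rewrite !cards1 mulr1 => sq_ge1.
  rewrite -(@ler_pXn2r _ 2) ?nnegrE ?expr1n ?(ltW mup0) //; apply: sq_ge1.
  by move=> x y; rewrite !inE => /eqP-> /eqP->; rewrite adj_irrefl.
have mup_le : mu * p <= mu by apply: ler_piMr => //; apply: ltW.
have mup2_le : mu * p ^+ 2 <= mu * p.
  by rewrite expr2 mulrA; apply: ler_piMr => //; apply: ltW.
have mup2_ge0 : 0 <= mu * p ^+ 2 by rewrite mulr_ge0 ?sqr_ge0 ?ltW.
have floor (x : R) : 0 <= x -> exists m : nat, m%:R <= x < m.+1%:R.
  by move=> x0; exists (Num.truncn x); apply: truncn_itv.
have [M Mgt M5] : exists2 M : nat, 4 * mu < M%:R & M%:R <= 5 * mu.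
  have [|m /andP[le_m lt_m]] := floor (4 * mu); first by lra.
  by exists m.+1 => //; rewrite -natr1; lra.
have M0 : (0 < M)%N by rewrite -(ltr_nat R); lra.
have [d /andP[dle dgt]] := floor _ mup2_ge0.
have dP (m : nat) : m%:R <= mu * p ^+ 2 -> (m <= d)%N.
  by move=> md; rewrite -ltnS -(ltr_nat R); apply: le_lt_trans dgt.
have [h hgt h2] : exists2 h : nat, mu * p < h%:R & h%:R <= 2 * (mu * p).
  have [m /andP[le_m lt_m]] := floor _ (ltW mup0).
  by exists m.+1 => //; rewrite -natr1; lra.
have szT : (n %/ 3 <= #|cover (singletons [set: G])|)%N.
  by rewrite cover_singletons cardsT Gn leq_div.
have [|Wf [_ /andP[]]] := @subfamily_of_size _ (singletons [set: G]) (n %/ 3) 1 _ szT.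
  by move=> S /imsetP[v _ ->]; rewrite cards1.
set W := cover Wf => W_ge W_le.
have nE : (n %/ 3)%:R * 3 = n%:R :> R by rewrite -natrM divnK.
have {}W_ge : n%:R / 3 <= #|W|%:R :> R.
  by move: W_ge; rewrite -(ler_nat R); lra.
have {}W_le : #|W|%:R <= n%:R / 3 + 1 :> R.
  by move: W_le; rewrite -(ler_nat R) natrD; lra.
pose s := trunc_log 2 (3 * M).
have pn : mu * p * 96 <= p * n%:R.
  have : mu * 96 <= n%:R by lra.
  by move=> /(ler_wpM2l (ltW p0)); lra.
apply: (@tileable_of_rich G M d h s.+1 W (sparse_into p W)) => //.
- by rewrite -(ler_nat R); lra.
- exact: square_jumbled_diamond_rich J p0 p1 mu0 Mgt.
- exact: square_jumbled_link_rich J p0 p1 mu0 Mgt dP.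
- move=> S hS; apply: (exists_edge J p0).
  have mS : mu * p < #|S|%:R.
    by apply: lt_le_trans hgt _; rewrite ler_nat.
  by rewrite expr2; apply: ltr_pM => //; apply: ltW.
- move=> v; apply: leq_trans (min_degree_le v); rewrite -(ler_nat R) natrD natrM.
  by apply: le_trans degG; lra.
- apply: dP; rewrite -[leLHS]mul1r; apply: card_sparse_into_le J p0 mu0 _.
  by lra.
- move=> v /notin_sparse_into; rewrite -(ler_nat R) natrD natrM.
  apply: le_trans; have := W_ge; rewrite -(ler_pM2l p0); lra.
- exact: ltnW (trunc_log_ltn _ _).
- rewrite Gn -(ler_nat R) (natrD _ (_ + #|W|)) (natrD _ (s.+1 * _)).
  rewrite (natrM _ s.+1) (natrM _ 28) (natrM _ 1000) (natrM _ 3) -[s.+1%:R]natr1.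
  (* The number of levels is at most [s + 1], with [2 ^ s <= 3 M <= 15 mu <= n]. *)
  have sn : (2 ^ s <= n)%N.
    apply: leq_trans (trunc_logP _ _) _; rewrite ?muln_gt0 //.
    by rewrite -(ler_nat R) natrM; lra.
  have := exponent_le_ln R sn; rewrite -/L => s_le.
  have s4 : s%:R + 1 <= 4 * L by lra.
  have sM : (s%:R + 1) * M%:R <= 4 * L * (5 * mu).
    by apply: ler_pM => //; rewrite addr_ge0.
  have {}sM : (s%:R + 1) * M%:R <= 20 * (e * n%:R) by rewrite -muL; lra.
  lra.
- by rewrite Gn.
Qed.
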